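(* Let $v\in\mathbb{C}^n=\mathbb{R}^{2n}$. Then $\overline{Gv}\cap\mathrm{Crit}(\mathbb{R}^{2n})$ is a single $K$-orbit $Ku$, and $\lim_{t\to+\infty}K\,F(t,v)=Ku$ in the quotient space $\mathbb{R}^{2n}/K$.
   Context: Let $G\subset GL(n,\mathbb{C})$ be a Zariski closed subgroup invariant under conjugate transpose, and $K=G\cap U(n)$. Identify $\mathbb{C}^n$ with $\mathbb{R}^{2n}=\mathbb{R}^n\oplus i\mathbb{R}^n$ (with its standard Euclidean inner product, the real part of the Hermitian one), so $G$ is a real algebraic subgroup of $GL(2n,\mathbb{R})$ invariant under transpose and $K=G\cap O(2n)$. Let $\mathfrak g$ be the (real) Lie algebra of $G$, $P_{\mathfrak g}$ the orthogonal projection of $M_{2n}(\mathbb{R})$ onto $\mathfrak g$ for the inner product $\mathrm{tr}(XY^{*})$, and $\phi(x)=\mathrm{tr}(P_{\mathfrak g}(xx^{*})^2)$ for $x\in\mathbb{R}^{2n}$. $F(t,x)$ is the solution of $\frac{d}{dt}F=-\nabla\phi(F)$, $F(0,x)=x$. $\mathrm{Crit}(\mathbb{R}^{2n})=\{x:\langle Xx,x\rangle=0\ \forall X\in\mathfrak g\}$. $\overline{Gv}$ is the closure of the orbit in the Euclidean topology. *)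

(* Defs.v *)
From Stdlib Require Import Reals Lra Lia Arith ClassicalEpsilon.
Open Scope R_scope.

Fixpoint sumR (N : nat) (f : nat -> R) : R :=
  match N with O => 0 | S k => sumR k f + f k end.

Definition Cx := (R * R)%type.
Definition C0 : Cx := (0, 0).
Definition C1 : Cx := (1, 0).
Definition Cadd (z w : Cx) : Cx := (fst z + fst w, snd z + snd w).
Definition Cmul (z w : Cx) : Cx :=
  (fst z * fst w - snd z * snd w, fst z * snd w + snd z * fst w).
Definition Cconj (z : Cx) : Cx := (fst z, - snd z).
Fixpoint sumC (N : nat) (f : nat -> Cx) : Cx :=
  match N with O => C0 | S k => Cadd (sumC k f) (f k) end.

(** Complex n x n matrices: only the entries with indices < n matter. *)
Definition cmat := nat -> nat -> Cx.
Definition cmul (n : nat) (A B : cmat) : cmat :=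
  fun i j => sumC n (fun k => Cmul (A i k) (B k j)).
Definition cid : cmat := fun i j => if Nat.eqb i j then C1 else C0.
Definition ceq (n : nat) (A B : cmat) : Prop :=
  forall i j, (i < n)%nat -> (j < n)%nat -> A i j = B i j.
Definition cinvertible (n : nat) (A : cmat) : Prop :=
  exists B, ceq n (cmul n A B) cid /\ ceq n (cmul n B A) cid.
Definition cadj (A : cmat) : cmat := fun i j => Cconj (A j i).

Inductive cpoly : Type :=
| PVar (i j : nat)
| PConst (c : Cx)
| PAdd (p q : cpoly)
| PMul (p q : cpoly).

Fixpoint ceval (n : nat) (A : cmat) (p : cpoly) : Cx :=
  match p with
  | PVar i j => if (Nat.ltb i n && Nat.ltb j n)%bool then A i j else C0
  | PConst c => c
  | PAdd p q => Cadd (ceval n A p) (ceval n A q)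
  | PMul p q => Cmul (ceval n A p) (ceval n A q)
  end.

Definition zariski_closed_GL (n : nat) (G : cmat -> Prop) : Prop :=
  exists S : cpoly -> Prop,
    forall A, G A <-> (cinvertible n A /\ forall p, S p -> ceval n A p = C0).

Definition subgroup_GL (n : nat) (G : cmat -> Prop) : Prop :=
  (forall A, G A -> cinvertible n A) /\
  G cid /\
  (forall A B, G A -> G B -> G (cmul n A B)) /\
  (forall A B, G A -> ceq n (cmul n A B) cid -> G B).

Definition adj_invariant (G : cmat -> Prop) : Prop :=
  forall A, G A -> G (cadj A).

(** Real vectors in R^N and real N x N matrices (entries with indices < N). *)
Definition vec := nat -> R.
Definition rmat := nat -> nat -> R.
Definition rmul (N : nat) (A B : rmat) : rmat :=
  fun i j => sumR N (fun k => A i k * B k j).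
Definition rid : rmat := fun i j => if Nat.eqb i j then 1 else 0.
Definition rzero : rmat := fun _ _ => 0.
Definition rsub (A B : rmat) : rmat := fun i j => A i j - B i j.
Definition rscal (t : R) (A : rmat) : rmat := fun i j => t * A i j.
Definition rapply (N : nat) (A : rmat) (x : vec) : vec :=
  fun i => sumR N (fun j => A i j * x j).
Definition rtrace (N : nat) (A : rmat) : R := sumR N (fun i => A i i).
Definition outer (x : vec) : rmat := fun i j => x i * x j.
Definition inner (N : nat) (x y : vec) : R := sumR N (fun i => x i * y i).
Definition frob (N : nat) (X Y : rmat) : R :=
  sumR N (fun i => sumR N (fun j => X i j * Y i j)).
Definition veq (N : nat) (x y : vec) : Prop :=
  forall i, (i < N)%nat -> x i = y i.
Definition dist (N : nat) (x y : vec) : R :=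
  sqrt (sumR N (fun i => (x i - y i) ^ 2)).

(** Identification C^n = R^n (+) i R^n = R^{2n}: the complex matrix
    A = P + iQ acts as the real 2n x 2n matrix [[P, -Q], [Q, P]]. *)
Definition realify (n : nat) (A : cmat) : rmat :=
  fun i j =>
    if Nat.ltb i n then
      (if Nat.ltb j n then fst (A i j) else - snd (A i (j - n)%nat))
    else
      (if Nat.ltb j n then snd (A (i - n)%nat j) else fst (A (i - n)%nat (j - n)%nat)).

Definition GR (n : nat) (G : cmat -> Prop) (M : rmat) : Prop :=
  exists A, G A /\ forall i j, (i < 2 * n)%nat -> (j < 2 * n)%nat ->
    M i j = realify n A i j.

Definition KR (n : nat) (G : cmat -> Prop) (M : rmat) : Prop :=
  GR n G M /\
  forall i j, (i < 2 * n)%nat -> (j < 2 * n)%nat ->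
    sumR (2 * n) (fun k => M k i * M k j) = rid i j.

Fixpoint rpow (N : nat) (X : rmat) (k : nat) : rmat :=
  match k with O => rid | S k' => rmul N (rpow N X k') X end.
Definition is_mexp (N : nat) (X E : rmat) : Prop :=
  forall i j, (i < N)%nat -> (j < N)%nat ->
    infinite_sum (fun k => rpow N X k i j / INR (fact k)) (E i j).

Definition lie (n : nat) (G : cmat -> Prop) (X : rmat) : Prop :=
  forall (t : R) (E : rmat), is_mexp (2 * n) (rscal t X) E -> GR n G E.

Definition is_proj (n : nat) (G : cmat -> Prop) (Y Z : rmat) : Prop :=
  lie n G Z /\ forall W, lie n G W -> frob (2 * n) (rsub Y Z) W = 0.
Definition projg (n : nat) (G : cmat -> Prop) (Y : rmat) : rmat :=
  epsilon (inhabits rzero) (fun Z => is_proj n G Y Z).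

Definition phi (n : nat) (G : cmat -> Prop) (x : vec) : R :=
  let Z := projg n G (outer x) in rtrace (2 * n) (rmul (2 * n) Z Z).

Definition basis_shift (x : vec) (i : nat) (s : R) : vec :=
  fun j => if Nat.eqb j i then x j + s else x j.
Definition is_grad (N : nat) (f : vec -> R) (x w : vec) : Prop :=
  forall i, (i < N)%nat -> derivable_pt_lim (fun s => f (basis_shift x i s)) 0 (w i).

Definition is_flow (n : nat) (G : cmat -> Prop) (v : vec) (F : R -> vec) : Prop :=
  veq (2 * n) (F 0) v /\
  forall t, 0 <= t ->
    exists w, is_grad (2 * n) (phi n G) (F t) w /\
      forall i, (i < 2 * n)%nat -> derivable_pt_lim (fun s => F s i) t (- w i).

Definition crit (n : nat) (G : cmat -> Prop) (x : vec) : Prop :=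
  forall X, lie n G X -> inner (2 * n) (rapply (2 * n) X x) x = 0.

Definition in_orbit_closure (n : nat) (G : cmat -> Prop) (v y : vec) : Prop :=
  forall eps, 0 < eps -> exists g, GR n G g /\ dist (2 * n) (rapply (2 * n) g v) y < eps.

Definition in_K_orbit (n : nat) (G : cmat -> Prop) (u y : vec) : Prop :=
  exists k, KR n G k /\ veq (2 * n) y (rapply (2 * n) k u).

(** Open subsets of R^N and K-invariant subsets; open subsets of R^{2n}/K are
    exactly the images of K-invariant (saturated) open subsets of R^{2n}. *)
Definition is_open (N : nat) (U : vec -> Prop) : Prop :=
  forall y, U y -> exists eps, 0 < eps /\ forall z, dist N z y < eps -> U z.
Definition K_invariant (n : nat) (G : cmat -> Prop) (U : vec -> Prop) : Prop :=
  forall k y, KR n G k -> U y -> U (rapply (2 * n) k y).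

Definition quotient_converges (n : nat) (G : cmat -> Prop) (F : R -> vec) (u : vec) : Prop :=
  forall U, is_open (2 * n) U -> K_invariant n G U -> U u ->
    exists T, forall t, T < t -> U (F t).

(* Main.v *)
(** A vector [u] of minimal norm in the closure of [Gv] is critical, by the first
variation along one-parameter groups.  Two critical points [x = lim A_j v] and
[y = lim B_j v] of the closure are conjugate under [K]: in a decomposition
[B_j A_j^-1 = k_j exp(d_j) l_j] with [d_j] diagonal in a fixed orthonormal basis
([G = KAK]) let [k_j] and [l_j] converge to [k] and [l], and let [a = l x],
[b = k^-1 y].  Both are critical, so [sum_i d_ji (b_i^2 - a_i^2) = 0], while [d_ji]
eventually has the sign of [b_i^2 - a_i^2]; hence [a = b].  The polar decomposition
behind [KAK] needs that an algebraic group contains the real powers of its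
positive definite elements, which holds because an exponential sum that vanishes
at the naturals vanishes identically.

The gradient of [phi] at [x] is [4 Z x], where [Z] is the projection of [x x^T] to
the Lie algebra.  Comparing the flow with the steps [exp (- 4 h Z)] shows that it
stays in the closure of [Gv].  Moreover [|F|^2] decreases at rate [8 phi(F)], so
[phi(F)] tends to 0 along some times [c_k -> oo]; limit points of [F(c_k)] are
critical, hence in [Ku].  So [|F|] decreases to [|u|], every limit point of the
flow has minimal norm, and therefore lies in [Ku]. *)

(* Convexity of the norm along one-parameter groups compares critical points inside one orbit; here
   they are only limits of one orbit, and the group elements that connect the approximations may
   diverge. Diagonalising the polar part of each [B_j A_j^-1] separately would give bases that move
   with [j]: the criticality relation would then hold in moving coordinates, and unbounded [d_ji]
   would leave no control where [a_i^2 = b_i^2]. In one basis for all [j] the relation is exact at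
   the limits, because the outer factors lie in [K], which is compact and preserves criticality.
   Hence KAK and not only the polar decomposition.

   The diagonal part is read off from a symmetric element of the Lie algebra with as few coinciding
   eigenvalues as possible. Both the conjugation into it and the spectral theorem come from
   maximising a trace over a compact group.

   The group enters through [(1 + D_m/(m+1))^(m+1) -> exp X] for [D_m -> X]: rescaled limits of
   group elements near 1 exponentiate into the group. *)
Require Import Defs.
From Stdlib Require Import Reals.
From mathcomp Require Import all_boot all_order all_algebra.
From mathcomp Require Import ring lra Rstruct Rstruct_topology.
From mathcomp Require Import mathcomp_extra boolp classical_sets functions filter.
From mathcomp Require Import reals topology normedtype sequences exp.
Import Order.TTheory GRing.Theory Num.Theory numFieldNormedType.Exports.

Set Implicit Arguments.
Unset Strict Implicit.
Unset Printing Implicit Defensive.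

Local Close Scope R_scope.
Local Open Scope classical_set_scope.
Local Open Scope ring_scope.

(** * Limits along an ultrafilter *)

(* Limits are taken along a fixed nonprincipal ultrafilter, so that every
   bounded sequence converges and no subsequences are needed. *)
Lemma nat_ultrafilter_exists :
  exists U : set_system nat, UltraFilter U /\ (\oo `<=` U).
Proof. exact: ultraFilterLemma. Qed.

Definition UF : set_system nat := projT1 (cid nat_ultrafilter_exists).

Instance UF_ultra : UltraFilter UF.
Proof. exact: (projT2 (cid nat_ultrafilter_exists)).1. Qed.

Lemma UF_oo : \oo `<=` UF.
Proof. exact: (projT2 (cid nat_ultrafilter_exists)).2. Qed.

Lemma UF_ge (n : nat) : \forall k \near UF, (n <= k)%N.
Proof. by apply: UF_oo; exists n. Qed.

Lemma cvg_UF (T : topologicalType) (f : nat -> T) (l : T) :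
  f @ \oo --> l -> f @ UF --> l.
Proof. by move=> h A /h; exact: UF_oo. Qed.

Section Limits.
Context {R : realType}.

(** The image of an ultrafilter is an ultrafilter, and one that contains a compact segment converges
    to a point of it. *)
Lemma bounded_cvg_UF (f : nat -> R) (M : R) :
  (\forall k \near UF, `|f k| <= M) -> exists l : R, f @ UF --> l.
Proof.
move=> hM.
have cpt := @segment_compact R (- M) M.
rewrite compact_ultra in cpt.
have UI : UltraFilter (f @ UF).
  apply: Build_UltraFilter => G PG sub; rewrite eqEsubset; split=> // A GA.
  have [//|hn] := in_ultra_setVsetC (f @^-1` A) UF_ultra.
  have GnA : G (~` A) by apply: (sub (~` A)); exact: hn.
  have := filterI GA GnA; rewrite setICr => G0.
  by exfalso; apply: (filter_not_empty G); exact: G0.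
have [|l [_ hl]] := cpt _ UI.
  rewrite /fmap /=; apply: filterS hM => k /=.
  by rewrite ler_norml in_itv.
by exists l.
Qed.

Lemma cvg_UF_unique (f : nat -> R) (a b : R) : f @ UF --> a -> f @ UF --> b -> a = b.
Proof. by move=> ha hb; exact: (cvg_unique _ ha hb). Qed.

Lemma cvg_UF_le (f : nat -> R) (a b : R) :
  f @ UF --> a -> (\forall k \near UF, f k <= b) -> a <= b.
Proof.
move=> ha hb; rewrite -(cvg_lim _ ha) //; apply: limr_le => //.
by apply/cvg_ex; exists a.
Qed.

Lemma cvg_UF_ge (f : nat -> R) (a b : R) :
  f @ UF --> a -> (\forall k \near UF, b <= f k) -> b <= a.
Proof.
move=> ha hb; rewrite -(cvg_lim _ ha) //; apply: limr_ge => //.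
by apply/cvg_ex; exists a.
Qed.

Lemma cvg_UF_squeeze (f g : nat -> R) (a : R) :
  g @ UF --> (0 : R) -> (\forall k \near UF, `|f k - a| <= g k) -> f @ UF --> a.
Proof.
move=> hg h; apply/cvgrPdist_lt => e e0.
move/cvgrPdist_lt : hg => /(_ e e0) hg.
near=> k.
have h1 : `|f k - a| <= g k by near: k.
have h2 : `|0 - g k| < e by near: k.
rewrite distrC (le_lt_trans h1) //.
by move: h2; rewrite sub0r normrN; apply: le_lt_trans; exact: ler_norm.
Unshelve. all: by end_near. Qed.

Lemma cvg_UF_near (f g : nat -> R) (a : R) :
  (\forall k \near UF, f k = g k) -> f @ UF --> a -> g @ UF --> a.
Proof. by move=> h; apply: cvg_trans; apply: near_eq_cvg; apply: filterS h. Qed.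

Lemma cvg_UF_add (f g : nat -> R) a b : f @ UF --> (a : R) -> g @ UF --> (b : R) ->
  (fun k => f k + g k) @ UF --> (a + b : R).
Proof. exact: cvgD. Qed.

Lemma cvg_UF_opp (f : nat -> R) a : f @ UF --> (a : R) -> (fun k => - f k) @ UF --> (- a : R).
Proof. exact: cvgN. Qed.

Lemma cvg_UF_mul (f g : nat -> R) a b : f @ UF --> (a : R) -> g @ UF --> (b : R) ->
  (fun k => f k * g k) @ UF --> (a * b : R).
Proof. exact: cvgM. Qed.

(** The shift by one matches [infinite_sum], whose partial sums include the term at the last
    index. *)
Lemma series_cvgP (u : nat -> R) (l : R) : series u @ \oo --> l <->
  forall e : R, 0 < e -> exists m, forall k, (m <= k)%N -> `|series u k.+1 - l| < e.
Proof.
rewrite -cvg_shiftS; split=> [/cvgrPdist_lt h e /h[m _ hm]|h].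
  by exists m => k mk; rewrite distrC; exact: hm.
by apply/cvgrPdist_lt => e /h[m hm]; exists m => // k mk /=; rewrite distrC; exact: hm.
Qed.

Lemma inv_cvg_UF : (fun k : nat => k.+1%:R^-1 : R) @ UF --> (0 : R).
Proof. by apply: cvg_UF; exact: cvg_harmonic. Qed.

Record mcv m n (A : nat -> 'M[R]_(m, n)) (L : 'M[R]_(m, n)) : Prop := Mcv {
  mcv_entry :> forall i j, (fun k => A k i j) @ UF --> L i j }.

Lemma mcv_unique m n (A : nat -> 'M[R]_(m, n)) L L' : mcv A L -> mcv A L' -> L = L'.
Proof. by move=> h h'; apply/matrixP => i j; apply: cvg_UF_unique (h i j) (h' i j). Qed.

Lemma mcv_cst m n (L : 'M[R]_(m, n)) : mcv (fun=> L) L.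
Proof. by split=> i j; exact: cvg_cst. Qed.

Lemma mcv_near m n (A B : nat -> 'M[R]_(m, n)) L :
  (\forall k \near UF, A k = B k) -> mcv A L -> mcv B L.
Proof.
move=> h hA; split=> i j; apply: cvg_trans (hA i j).
by apply: near_eq_cvg; apply: filterS h => k ->.
Qed.

Lemma mcvD m n (A B : nat -> 'M[R]_(m, n)) L L' :
  mcv A L -> mcv B L' -> mcv (fun k => A k + B k) (L + L').
Proof.
move=> hA hB; split=> i j; rewrite mxE; under eq_fun do rewrite mxE.
exact: cvgD (hA i j) (hB i j).
Qed.

Lemma mcvN m n (A : nat -> 'M[R]_(m, n)) L : mcv A L -> mcv (fun k => - A k) (- L).
Proof.
move=> hA; split=> i j; rewrite mxE; under eq_fun do rewrite mxE.
exact: cvgN (hA i j).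
Qed.

Lemma mcvB m n (A B : nat -> 'M[R]_(m, n)) L L' :
  mcv A L -> mcv B L' -> mcv (fun k => A k - B k) (L - L').
Proof. by move=> hA hB; apply: mcvD => //; exact: mcvN. Qed.

Lemma mcvZ m n (a : nat -> R) (A : nat -> 'M[R]_(m, n)) (l : R) L :
  a @ UF --> l -> mcv A L -> mcv (fun k => a k *: A k) (l *: L).
Proof.
move=> ha hA; split=> i j; rewrite mxE; under eq_fun do rewrite mxE.
exact: cvgM ha (hA i j).
Qed.

Lemma cvg_UF_sum (I : Type) (r : seq I) (P : pred I) (f : I -> nat -> R) (l : I -> R) :
  (forall i, P i -> f i @ UF --> l i) ->
  (fun k => \sum_(i <- r | P i) f i k) @ UF --> \sum_(i <- r | P i) l i.
Proof.
move=> h; elim: r => [|a r IH].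
  by rewrite big_nil; under eq_fun do rewrite big_nil; exact: cvg_cst.
rewrite big_cons; under eq_fun do rewrite big_cons.
case: ifP => Pa //; exact: cvgD (h _ Pa) IH.
Qed.

Lemma mcvM m n p (A : nat -> 'M[R]_(m, n)) (B : nat -> 'M[R]_(n, p)) L L' :
  mcv A L -> mcv B L' -> mcv (fun k => A k *m B k) (L *m L').
Proof.
move=> hA hB; split=> i j; rewrite mxE; under eq_fun do rewrite mxE.
by apply: cvg_UF_sum => l _; exact: cvgM (hA _ _) (hB _ _).
Qed.

Lemma mcvT m n (A : nat -> 'M[R]_(m, n)) L : mcv A L -> mcv (fun k => (A k)^T) L^T.
Proof. by move=> hA; split=> i j; rewrite mxE; under eq_fun do rewrite mxE; exact: hA. Qed.

Lemma mcv_tr n (A : nat -> 'M[R]_n) L : mcv A L -> (fun k => \tr (A k)) @ UF --> \tr L.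
Proof. by move=> hA; apply: cvg_UF_sum => i _; exact: hA. Qed.

(** This norm is submultiplicative for rectangular matrices too and bounds every entry. Its price is
    that the identity has norm [N], whence the constant [c] in the estimates for powers. *)
Definition nrm m n (A : 'M[R]_(m, n)) : R := \sum_i \sum_j `|A i j|.

Lemma nrm_ge0 m n (A : 'M[R]_(m, n)) : 0 <= nrm A.
Proof. by apply: sumr_ge0 => i _; apply: sumr_ge0 => j _. Qed.

Lemma nrm_entry m n (A : 'M[R]_(m, n)) i j : `|A i j| <= nrm A.
Proof.
rewrite /nrm (bigD1 i) //= (bigD1 j) //= -addrA lerDl addr_ge0 //.
  exact: sumr_ge0.
by apply: sumr_ge0 => i' _; exact: sumr_ge0.
Qed.

Lemma nrmD m n (A B : 'M[R]_(m, n)) : nrm (A + B) <= nrm A + nrm B.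
Proof.
rewrite /nrm -big_split /=; apply: ler_sum => i _.
rewrite -big_split /=; apply: ler_sum => j _.
by rewrite mxE; exact: ler_normD.
Qed.

Lemma nrmZ m n a (A : 'M[R]_(m, n)) : nrm (a *: A) = `|a| * nrm A.
Proof.
rewrite /nrm mulr_sumr; apply: eq_bigr => i _; rewrite mulr_sumr.
by apply: eq_bigr => j _; rewrite mxE normrM.
Qed.

Lemma nrmN m n (A : 'M[R]_(m, n)) : nrm (- A) = nrm A.
Proof. by rewrite -scaleN1r nrmZ normrN1 mul1r. Qed.

Lemma nrm0 m n : nrm (0 : 'M[R]_(m, n)) = 0.
Proof. by rewrite -[X in nrm X](scale0r 0) nrmZ normr0 mul0r. Qed.

Lemma nrm_sum m n (I : Type) (r : seq I) (f : I -> 'M[R]_(m, n)) :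
  nrm (\sum_(i <- r) f i) <= \sum_(i <- r) nrm (f i).
Proof.
elim: r => [|a r IH]; first by rewrite !big_nil nrm0.
by rewrite !big_cons; apply: le_trans (nrmD _ _) _; rewrite lerD2l.
Qed.

Lemma nrmT m n (A : 'M[R]_(m, n)) : nrm A^T = nrm A.
Proof.
rewrite /nrm exchange_big /=; apply: eq_bigr => i _; apply: eq_bigr => j _.
by rewrite mxE.
Qed.

Lemma nrmM m n p (A : 'M[R]_(m, n)) (B : 'M[R]_(n, p)) : nrm (A *m B) <= nrm A * nrm B.
Proof.
rewrite /nrm mulr_suml; apply: ler_sum => i _.
apply: (@le_trans _ _ (\sum_j \sum_k `|A i k| * `|B k j|)).
  apply: ler_sum => j _; rewrite mxE (le_trans (ler_norm_sum _ _ _)) //.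
  by apply: ler_sum => k _; rewrite normrM.
rewrite exchange_big mulr_suml /=; apply: ler_sum => k _.
rewrite -mulr_sumr ler_wpM2l // (bigD1 k) //= lerDl.
by apply: sumr_ge0 => l _; exact: sumr_ge0.
Qed.

Lemma mcv_nrm m n (A : nat -> 'M[R]_(m, n)) L :
  mcv A L -> (fun k => nrm (A k)) @ UF --> nrm L.
Proof.
move=> hA; apply: cvg_UF_sum => i _; apply: cvg_UF_sum => j _.
exact: cvg_norm (hA i j).
Qed.

Lemma mcv_nrm0 m n (A : nat -> 'M[R]_(m, n)) L :
  (fun k => nrm (A k - L)) @ UF --> (0 : R) -> mcv A L.
Proof.
move=> h; split=> i j; apply: cvg_UF_squeeze h _; apply: nearW => k.
by have := nrm_entry (A k - L) i j; rewrite !mxE.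
Qed.

Lemma mcv_squeeze m n (A : nat -> 'M[R]_(m, n)) L (g : nat -> R) :
  g @ UF --> (0 : R) -> (\forall k \near UF, nrm (A k - L) <= g k) -> mcv A L.
Proof.
move=> hg h; apply: mcv_nrm0; apply: cvg_UF_squeeze hg _.
by apply: filterS h => k; rewrite subr0 ger0_norm ?nrm_ge0.
Qed.

Lemma bounded_mcv m n (A : nat -> 'M[R]_(m, n)) (M : R) :
  (\forall k \near UF, nrm (A k) <= M) -> exists L, mcv A L.
Proof.
move=> hM.
have h i j : exists l : R, (fun k => A k i j) @ UF --> l.
  apply: (@bounded_cvg_UF _ M); apply: filterS hM => k.
  exact: le_trans (nrm_entry _ _ _).
have [L hL] : exists L : 'I_m -> 'I_n -> R, forall i j, (fun k => A k i j) @ UF --> L i j.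
  exists (fun i j => projT1 (cid (h i j))) => i j; exact: projT2 (cid (h i j)).
by exists (\matrix_(i, j) L i j); split=> i j; rewrite mxE.
Qed.

Lemma mcv_bounded m n (A : nat -> 'M[R]_(m, n)) L :
  mcv A L -> \forall k \near UF, nrm (A k) <= nrm L + 1.
Proof.
move=> /mcv_nrm /cvgrPdist_lt /(_ 1 ltr01); apply: filterS => k.
rewrite ltr_norml => /andP[h _]; lra.
Qed.

Definition dot m n (A B : 'M[R]_(m, n)) : R := \tr (A^T *m B).

Lemma dotE m n (A B : 'M[R]_(m, n)) : dot A B = \sum_i \sum_j A i j * B i j.
Proof.
rewrite /dot /mxtrace exchange_big /=; apply: eq_bigr => j _; rewrite mxE.
by apply: eq_bigr => i _; rewrite mxE.
Qed.

Lemma dotC m n (A B : 'M[R]_(m, n)) : dot A B = dot B A.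
Proof. by rewrite /dot -mxtrace_tr trmx_mul trmxK. Qed.

Lemma dotDl m n (A B C : 'M[R]_(m, n)) : dot (A + B) C = dot A C + dot B C.
Proof. by rewrite /dot linearD /= mulmxDl linearD. Qed.
Lemma dotZl m n a (A C : 'M[R]_(m, n)) : dot (a *: A) C = a * dot A C.
Proof. by rewrite /dot linearZ /= -scalemxAl linearZ. Qed.
Lemma dotNl m n (A C : 'M[R]_(m, n)) : dot (- A) C = - dot A C.
Proof. by rewrite -scaleN1r dotZl mulN1r. Qed.
Lemma dotBl m n (A B C : 'M[R]_(m, n)) : dot (A - B) C = dot A C - dot B C.
Proof. by rewrite dotDl dotNl. Qed.
Lemma dotDr m n (A B C : 'M[R]_(m, n)) : dot C (A + B) = dot C A + dot C B.
Proof. by rewrite !(dotC C) dotDl. Qed.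
Lemma dotZr m n a (A C : 'M[R]_(m, n)) : dot C (a *: A) = a * dot C A.
Proof. by rewrite !(dotC C) dotZl. Qed.
Lemma dotBr m n (A B C : 'M[R]_(m, n)) : dot C (A - B) = dot C A - dot C B.
Proof. by rewrite !(dotC C) dotBl. Qed.
Lemma dot0l m n (C : 'M[R]_(m, n)) : dot 0 C = 0.
Proof. by rewrite -[X in dot X _](scale0r 0) dotZl mul0r. Qed.

Lemma dot_ge0 m n (A : 'M[R]_(m, n)) : 0 <= dot A A.
Proof.
by rewrite dotE; do 2!apply: sumr_ge0 => ? _; rewrite -expr2 sqr_ge0.
Qed.

Lemma sqr_entry_le_dot m n (A : 'M[R]_(m, n)) i j : A i j ^+ 2 <= dot A A.
Proof.
rewrite dotE (bigD1 i) //= (bigD1 j) //= -addrA -expr2 lerDl addr_ge0 //.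
  by apply: sumr_ge0 => ? _; rewrite -expr2 sqr_ge0.
by do 2!apply: sumr_ge0 => ? _; rewrite -expr2 sqr_ge0.
Qed.

Lemma dot_eq0 m n (A : 'M[R]_(m, n)) : dot A A = 0 -> A = 0.
Proof.
move=> h; apply/matrixP => i j; rewrite mxE; apply/eqP.
by rewrite -sqrf_eq0 -(@le_anti _ R (A i j ^+ 2) 0) // sqr_ge0 andbT -h sqr_entry_le_dot.
Qed.

Lemma dot_le_sqr_nrm m n (A : 'M[R]_(m, n)) : dot A A <= nrm A ^+ 2.
Proof.
rewrite expr2 {1}/nrm mulr_suml dotE; apply: ler_sum => i _.
rewrite mulr_suml; apply: ler_sum => j _.
by apply: le_trans (ler_norm _) _; rewrite normrM ler_wpM2l // nrm_entry.
Qed.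

(** Each entry satisfies [|a| <= a^2 + 1]. The bound is crude, but it turns bounded inner products
    into bounded norms without square roots. *)
Lemma nrm_le_dot m n (A : 'M[R]_(m, n)) : nrm A <= (m * n)%:R * (dot A A + 1).
Proof.
rewrite /nrm natrM -mulrA.
have -> : m%:R * (n%:R * (dot A A + 1)) = \sum_(i < m) \sum_(j < n) (dot A A + 1).
  by rewrite !sumr_const !card_ord -[in RHS]mulr_natl -[(_ + 1) *+ n]mulr_natl.
apply: ler_sum => i _; apply: ler_sum => j _.
have := sqr_entry_le_dot A i j; rewrite -real_normK ?num_real // => h.
have := sqr_ge0 (`|A i j| - 1); nra.
Qed.

Lemma mcv_dot m n (A B : nat -> 'M[R]_(m, n)) L L' :
  mcv A L -> mcv B L' -> (fun k => dot (A k) (B k)) @ UF --> dot L L'.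
Proof. by move=> hA hB; apply: mcv_tr; apply: mcvM => //; exact: mcvT. Qed.

(** The direct method: a minimising sequence with values below [inf + 1/(k+1)] stays in the sublevel
    [f x0 + 1], where points are bounded, and its limit along [UF] is a minimiser. *)
Lemma min_attained m n (S : 'M[R]_(m, n) -> Prop) (f : 'M[R]_(m, n) -> R) (c : R) x0 :
  S x0 -> (forall x, S x -> c <= f x) ->
  (exists M, forall x, S x -> f x <= f x0 + 1 -> nrm x <= M) ->
  (forall A L, (forall k, S (A k)) -> mcv A L -> S L) ->
  (forall A L, mcv A L -> (fun k => f (A k)) @ UF --> f L) ->
  exists2 x, S x & forall y, S y -> f x <= f y.
Proof.
move=> S0 lb [M hM] clo cont.
pose I := [set f x | x in [set x | S x]].
have hinf : has_inf I.
  split; first by exists (f x0); exists x0.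
  by exists c => _ [x Sx <-]; exact: lb.
have [x hx] : exists x : nat -> 'M[R]_(m, n),
    forall k, S (x k) /\ f (x k) < inf I + k.+1%:R^-1.
  have h k : exists x, S x /\ f x < inf I + k.+1%:R^-1.
    have [_ [x Sx <-] h] := @inf_adherent R I k.+1%:R^-1 ltac:(by rewrite invr_gt0) hinf.
    by exists x.
  by exists (fun k => projT1 (cid (h k))) => k; exact: projT2 (cid (h k)).
have infle y : S y -> inf I <= f y by move=> Sy; apply: (ge_inf hinf.2); exists y.
have [L hL] : exists L, mcv x L.
  apply: (@bounded_mcv _ _ _ M); apply: nearW => k; have [Sx h] := hx k.
  apply: hM => //; apply: ltW; apply: lt_le_trans h _.
  by rewrite lerD ?infle // invf_le1 ?ler1n.
have SL : S L by apply: clo hL => k; case: (hx k).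
exists L => // y Sy; apply: le_trans (infle _ Sy).
have h1 : (fun k => inf I + k.+1%:R^-1) @ UF --> inf I + 0.
  by apply: cvgD; [exact: cvg_cst | exact: inv_cvg_UF].
rewrite addr0 in h1.
have h2 := cvgB (cont _ _ hL) h1.
rewrite -subr_le0; apply: (cvg_UF_le (h2 _)); apply: nearW => k.
by rewrite /= subr_le0; apply: ltW; case: (hx k).
Qed.

End Limits.

(** * Matrix exponential *)

Section MatrixExp.
Context {R : realType} {N : nat}.
Implicit Types X Y Z A B D : 'M[R]_N.

Let c : R := N.+1%:R.

Lemma nrm1 : nrm (1 : 'M[R]_N) <= c.
Proof.
rewrite /nrm /c; apply: (@le_trans _ _ (\sum_(i < N) 1)).
  apply: ler_sum => i _; rewrite (bigD1 i) //= big1 => [|j /negPf ji].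
    by rewrite mxE eqxx addr0 normr1.
  by rewrite mxE eq_sym ji normr0.
by rewrite sumr_const card_ord ler_nat.
Qed.

Lemma nrmX X k : nrm (X ^+ k) <= c * nrm X ^+ k.
Proof.
elim: k => [|k IH]; first by rewrite !expr0 mulr1 nrm1.
rewrite exprSr (le_trans (nrmM _ _)) // exprSr mulrA ler_wpM2r ?nrm_ge0 //.
Qed.

Lemma nrmXS X k : nrm (X ^+ k.+1) <= nrm X ^+ k.+1.
Proof.
elim: k => [|k IH]; first by rewrite !expr1.
rewrite exprSr (le_trans (nrmM _ _)) // [leRHS]exprSr ler_wpM2r ?nrm_ge0 //.
Qed.

Definition expS X m : 'M[R]_N := \sum_(k < m) k`!%:R^-1 *: X ^+ k.

Definition expRS (a : R) m : R := \sum_(k < m) k`!%:R^-1 * a ^+ k.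

Lemma expRSE a m : expRS a m = series (exp_coeff a) m.
Proof.
rewrite /series /= big_mkord; apply: eq_bigr => k _.
by rewrite /exp_coeff /= mulrC.
Qed.

Lemma cvg_expRS a : expRS a @ UF --> expR a.
Proof.
have -> : expRS a = series (exp_coeff a) by apply/funext => m; exact: expRSE.
by apply: cvg_UF; exact: is_cvg_series_exp_coeff.
Qed.

Lemma expRS_le a m : 0 <= a -> expRS a m <= expR a.
Proof.
move=> a0; rewrite expRSE; apply: nondecreasing_cvgn_le; last exact: is_cvg_series_exp_coeff.
apply/nondecreasing_seqP => k; rewrite !seriesEnat /= big_nat_recr //= lerDl.
exact: exp_coeff_ge0.
Qed.

Lemma expRSB a (m p : nat) : (m <= p)%N ->
  expRS a p - expRS a m = \sum_(m <= k < p) k`!%:R^-1 * a ^+ k.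
Proof.
move=> mp; rewrite /expRS -!(big_mkord predT (fun k => k`!%:R^-1 * a ^+ k)).
by rewrite (big_cat_nat (leq0n _) mp) //= addrAC subrr add0r.
Qed.

(** The coefficients are left free so that the estimate serves both the exponential series and the
    binomial expansions that tend to it. *)
Lemma nrm_term (d : nat -> R) Z (a : R) k : nrm Z <= a ->
  `|d k| <= k`!%:R^-1 -> nrm (d k *: Z ^+ k) <= c * (k`!%:R^-1 * a ^+ k).
Proof.
move=> Za dk; rewrite nrmZ mulrCA ler_pM ?nrm_ge0 //.
apply: le_trans (nrmX _ _) _; rewrite ler_wpM2l ?ler0n // lerXn2r ?nnegrE ?nrm_ge0 //.
exact: le_trans (nrm_ge0 _) Za.
Qed.

Lemma nrm_expS X m : nrm (expS X m) <= c * expR (nrm X).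
Proof.
apply: (@le_trans _ _ (c * expRS (nrm X) m)); last first.
  by rewrite ler_wpM2l ?ler0n // expRS_le ?nrm_ge0.
rewrite /expS (le_trans (nrm_sum _ _)) // /expRS mulr_sumr; apply: ler_sum => k _.
by apply: (nrm_term (d := fun k => k`!%:R^-1)) => //; rewrite ger0_norm ?invr_ge0.
Qed.

Lemma mexp_exists X : exists E, mcv (expS X) E.
Proof. by apply: (bounded_mcv (M := c * expR (nrm X))); apply: nearW => m; exact: nrm_expS. Qed.

(** A limit along the ultrafilter only; ordinary convergence of the series is established in
    [expS_entry_cvg]. *)
Definition mexp X : 'M[R]_N := projT1 (cid (mexp_exists X)).

Lemma cvg_mexp X : mcv (expS X) (mexp X).
Proof. exact: projT2 (cid (mexp_exists X)). Qed.

Lemma mexp_unique X E : mcv (expS X) E -> E = mexp X.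
Proof. by move=> h; apply: mcv_unique h (cvg_mexp X). Qed.

(** Shift the series by two: [1/(k+2)! <= 1/k!], and [nrmXS], which has no factor [c] because the
    exponent is positive, splits off [nrm X ^+ 2]. *)
Lemma mexp_approx X : nrm (mexp X - 1 - X) <= nrm X ^+ 2 * expR (nrm X).
Proof.
have h : mcv (fun m => expS X m - 1 - X) (mexp X - 1 - X).
  by apply: mcvB; [apply: mcvB; [exact: cvg_mexp | exact: mcv_cst] | exact: mcv_cst].
apply: cvg_UF_le (mcv_nrm h) _; apply: filterS (UF_ge 2) => -[//|[//|m]] _.
rewrite /expS 2!big_ord_recl fact0 invr1 !scale1r expr0 [X ^+ lift _ _]expr1.
rewrite [1 + _]addrC addrK [X + _]addrC addrK.
apply: le_trans (nrm_sum _ _) _.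
apply: (@le_trans _ _ (nrm X ^+ 2 * expRS (nrm X) m)); last first.
  by rewrite ler_wpM2l ?sqr_ge0 // expRS_le ?nrm_ge0.
rewrite /expRS mulr_sumr; apply: ler_sum => k _.
rewrite nrmZ mulrCA ler_pM ?nrm_ge0 //.
  rewrite ger0_norm ?invr_ge0 // lef_pV2 ?posrE ?ltr0n ?fact_gt0 // ler_nat.
  by rewrite !lift0 !factS mulnA leq_pmull.
by rewrite -exprD !lift0; exact: nrmXS.
Qed.

(** Up to the factor [1/k!] this is a product of [k] factors [1 - i/(m+1)], each tending to 1. *)
Lemma binom_coeff_cvg k :
  (fun m : nat => 'C(m.+1, k)%:R / m.+1%:R ^+ k : R) @ UF --> (k`!%:R^-1 : R).
Proof.
have hq : (fun m : nat => (m.+1 ^_ k)%:R / m.+1%:R ^+ k : R) @ UF --> (1 : R).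
  elim: k => [|k IH].
    under eq_fun do rewrite ffactn0 expr0 divr1.
    exact: cvg_cst.
  have h2 : (fun m : nat => 1 - k%:R * m.+1%:R^-1 : R) @ UF --> (1 - k%:R * 0 : R).
    by apply: cvgB; [exact: cvg_cst | apply: cvgM; [exact: cvg_cst | exact: inv_cvg_UF]].
  have h3 := cvgM IH h2; rewrite mulr0 subr0 mulr1 in h3.
  apply: cvg_UF_near (h3 _); apply: filterS (UF_ge k) => m km.
  rewrite ffactnSr natrM natrB ?(leq_trans km) // exprSr.
  have m0 : m.+1%:R != 0 :> R by rewrite pnatr_eq0.
  have m1 : m.+1%:R ^+ k != 0 :> R by rewrite expf_neq0.
  by move: m0 m1 => /=; move: (m.+1%:R : R) => y y0 y1; field; rewrite y1 y0.
have h3 := cvgM hq (cvg_cst (k`!%:R^-1 : R)).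
rewrite mul1r in h3.
apply: cvg_UF_near (h3 _ _); apply: nearW => m /=.
have f0 : k`!%:R != 0 :> R by rewrite pnatr_eq0 -lt0n fact_gt0.
by rewrite -bin_ffact natrM mulrAC mulfK.
Qed.

Lemma binom_coeff_le m k : `|'C(m.+1, k)%:R / m.+1%:R ^+ k : R| <= k`!%:R^-1.
Proof.
have f0 : 0 < k`!%:R :> R by rewrite ltr0n fact_gt0.
have m0 : 0 < m.+1%:R ^+ k :> R by rewrite exprn_gt0 ?ltr0n.
rewrite ger0_norm ?divr_ge0 ?exprn_ge0 // ler_pdivrMr // mulrC ler_pdivlMr //.
rewrite -natrM bin_ffact -natrX ler_nat.
elim: k {f0 m0} => [|k IH]; first by rewrite ffactn0.
by rewrite ffactnSr expnSr leq_mul // leq_subr.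
Qed.

Lemma mxscaleX a X k : (a *: X) ^+ k = a ^+ k *: X ^+ k.
Proof.
elim: k => [|k IH]; first by rewrite !expr0 scale1r.
by rewrite !exprS IH -!mulmxE -scalemxAl -scalemxAr scalerA.
Qed.

Lemma euler_expand (D : 'M[R]_N) m :
  (1 + m.+1%:R^-1 *: D) ^+ m.+1
  = \sum_(k < m.+2) ('C(m.+1, k)%:R / m.+1%:R ^+ k) *: D ^+ k.
Proof.
rewrite exprDn_comm; last exact: commr_sym (commr1 _).
apply: eq_bigr => k _; rewrite expr1n mul1r mxscaleX -scaler_nat scalerA exprVn //.
Qed.

(* Dominated convergence of the binomial expansions. *)
Lemma euler_limit (D : nat -> 'M[R]_N) X : mcv D X ->
  mcv (fun m => (1 + m.+1%:R^-1 *: D m) ^+ m.+1) (mexp X).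
Proof.
move=> hD; pose M := nrm X + 1.
have hM : \forall m \near UF, nrm (D m) <= M by exact: mcv_bounded.
have M0 : 0 <= M by rewrite addr_ge0 ?nrm_ge0.
pose P m := (1 + m.+1%:R^-1 *: D m) ^+ m.+1.
pose b m k : R := 'C(m.+1, k)%:R / m.+1%:R ^+ k.
(* Cutting the expansion at [K] costs at most a tail of the series of [expR M], uniformly in [m].
   The case [K = 0] bounds the whole sequence; for the other [K], letting [m] grow compares its
   limit with [expS X K]. *)
have tail K : \forall m \near UF,
    nrm (P m - \sum_(k < K) b m k *: D m ^+ k) <= c * (expR M - expRS M K).
  near=> m.
  have Km : (K <= m.+2)%N by near: m; apply: filterS (UF_ge K) => m Km; do 2!apply: leqW.
  have Dm : nrm (D m) <= M by near: m.
  rewrite /P euler_expand -!(big_mkord predT (fun k => b m k *: D m ^+ k)).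
  rewrite (big_cat_nat (leq0n _) Km) //= addrAC subrr add0r (le_trans (nrm_sum _ _)) //.
  apply: (@le_trans _ _ (\sum_(K <= k < m.+2) c * (k`!%:R^-1 * M ^+ k))).
    by apply: ler_sum => k _; apply: nrm_term => //; exact: binom_coeff_le.
  by rewrite -mulr_sumr -expRSB // ler_wpM2l ?ler0n // lerB // expRS_le.
have [L hL] : exists L, mcv P L.
  apply: (bounded_mcv (M := c * expR M)); apply: filterS (tail 0%N) => m.
  by rewrite big_ord0 subr0 /expRS big_ord0 subr0.
suff -> : mexp X = L by [].
apply/esym/mexp_unique.
have powD k : mcv (fun m => D m ^+ k) (X ^+ k).
  elim: k => [|k IH]; first exact: mcv_cst.
  by rewrite exprS; under eq_fun do rewrite exprS; exact: mcvM.
have h K : nrm (L - expS X K) <= c * (expR M - expRS M K).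
  apply: cvg_UF_le (tail K); apply: mcv_nrm; apply: mcvB => //.
  rewrite /expS; elim: K => [|K IH].
    by rewrite big_ord0; under eq_fun do rewrite big_ord0; exact: mcv_cst.
  rewrite big_ord_recr /=; under eq_fun do rewrite big_ord_recr /=.
  by apply: mcvD => //; apply: mcvZ => //; exact: binom_coeff_cvg.
have hg : (fun K => c * (expR M - expRS M K)) @ UF --> c * (expR M - expR M).
  by apply: cvgM; [exact: cvg_cst | apply: cvgB; [exact: cvg_cst | exact: cvg_expRS]].
rewrite subrr mulr0 in hg.
apply: mcv_squeeze hg _; apply: nearW => K; by rewrite -nrmN opprB.
Unshelve. all: by end_near. Qed.

Lemma mexp0 : mexp 0 = 1.
Proof.
apply/esym/mexp_unique; apply: mcv_near (mcv_cst (1 : 'M[R]_N)).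
apply: filterS (UF_ge 1) => -[//|m] _.
rewrite /expS big_ord_recl fact0 invr1 scale1r expr0 big1 ?addr0 // => i _.
by rewrite expr0n scaler0.
Qed.

(** With [e = 1/(m+1)], [(1 + e X)(1 - e X) = 1 + e D_m] where [D_m = - e X^2] tends to 0, so the
    product of the two Euler limits is [mexp 0]. This is where the varying [D] of [euler_limit]
    replaces a product of series. *)
Lemma mexpN X : mexp X *m mexp (- X) = 1%:M.
Proof.
have h := mcvM (euler_limit (mcv_cst X)) (euler_limit (mcv_cst (- X))).
have -> : 1%:M = mexp 0 by rewrite mexp0.
apply: mcv_unique h _.
have hD : mcv (fun m => - m.+1%:R^-1 *: (X * X)) 0.
  rewrite -[X in mcv _ X](scale0r (X * X)) -oppr0.
  by apply: mcvZ; [apply: cvgN; exact: inv_cvg_UF | exact: mcv_cst].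
apply: mcv_near (euler_limit hD); apply: nearW => m.
set e := m.+1%:R^-1.
rewrite -[RHS]/(_ * _) -exprMn_comm.
  congr (_ ^+ _); rewrite mulrDl mul1r mulrDr mulr1 scalerN addrA.
  rewrite addrNK; congr (_ + _).
  by rewrite -!mulmxE mulmxN -scalemxAl -scalemxAr scaleNr scalerN.
apply: commrD; first exact: commr1.
apply/commr_sym; apply: commrD; first exact: commr1.
by rewrite /GRing.comm -!mulmxE -!scalemxAl -!scalemxAr mulmxN mulNmx.
Qed.

Lemma mexpNl X : mexp (- X) *m mexp X = 1%:M.
Proof. by rewrite -{2}[X]opprK mexpN. Qed.

Lemma mexp_unit X : mexp X \in unitmx.
Proof. by case: (mulmx1_unit (mexpN X)). Qed.

Lemma mexp_conj P Q X : Q *m P = 1%:M -> mexp (P *m X *m Q) = P *m mexp X *m Q.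
Proof.
move=> QP; apply/esym/mexp_unique.
have PQ : P *m Q = 1%:M by apply: mulmx1C.
have h : mcv (fun m => P *m expS X m *m Q) (P *m mexp X *m Q).
  by apply: mcvM; [apply: mcvM; [exact: mcv_cst | exact: cvg_mexp] | exact: mcv_cst].
apply: mcv_near h; apply: nearW => m; rewrite /expS mulmx_sumr mulmx_suml.
apply: eq_bigr => k _; rewrite -scalemxAr -scalemxAl; congr (_ *: _).
elim: (k : nat) => [|i IH]; first by rewrite !expr0 mulmx1 PQ.
rewrite !exprSr -IH -[in RHS]mulmxE !mulmxA; congr (_ *m _ *m _).
by rewrite -mulmxA QP mulmx1.
Qed.

Lemma mexpT X : mexp X^T = (mexp X)^T.
Proof.
apply/esym/mexp_unique; apply: mcv_near (mcvT (cvg_mexp X)); apply: nearW => m.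
rewrite /expS linear_sum; apply: eq_bigr => k _; rewrite linearZ /=; congr (_ *: _).
elim: (k : nat) => [|i IH]; first by rewrite !expr0 trmx1.
by rewrite exprS exprSr -mulmxE trmx_mul IH mulmxE.
Qed.

Lemma mexp_comm X Y : X *m Y = Y *m X -> mexp X *m Y = Y *m mexp X.
Proof.
move=> h; apply: mcv_unique (mcvM (cvg_mexp X) (mcv_cst Y)) _.
apply: mcv_near (mcvM (mcv_cst Y) (cvg_mexp X)); apply: nearW => m.
rewrite /expS mulmx_suml mulmx_sumr; apply: eq_bigr => k _.
rewrite -scalemxAr -scalemxAl; congr (_ *: _).
by apply: commrX.
Qed.

Lemma mexp_diag (d : 'rV[R]_N) : mexp (diag_mx d) = diag_mx (map_mx expR d).
Proof.
apply/esym/mexp_unique; split=> i j; rewrite !mxE.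
have h m : expS (diag_mx d) m i j = expRS (d 0 i) m *+ (i == j).
  rewrite /expS /expRS summxE -sumrMnl; apply: eq_bigr => k _; rewrite mxE -mulrnAr.
  congr (_ * _); elim: (k : nat) => [|l IH]; first by rewrite !expr0 mxE.
  rewrite exprSr -mulmxE mul_mx_diag mxE IH exprSr mulrnAl.
  by case: (i =P j) => [->|]; rewrite ?mulr0n.
under eq_fun do rewrite h.
case: (i == j); last by under eq_fun do rewrite mulr0n; exact: cvg_cst.
by under eq_fun do rewrite mulr1n; exact: cvg_expRS.
Qed.

(** The series converges absolutely by comparison with [c] times that of [expR (nrm X)], and its sum
    must agree with the limit along [UF]. It is needed because [is_mexp] asks for ordinary
    convergence. *)
Lemma expS_entry_cvg X i j : (fun m => expS X m i j) @ \oo --> (mexp X i j : R).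
Proof.
pose u k : R := k`!%:R^-1 * (X ^+ k) i j.
have eu : (fun m => expS X m i j) = series u.
  by apply/funext => m; rewrite /series /= big_mkord /expS summxE; apply: eq_bigr => k _; rewrite mxE.
have cu : cvgn (series u).
  apply: normed_cvg; apply: (@series_le_cvg _ _ (fun k => c * exp_coeff (nrm X) k)).
  - by move=> k; exact: normr_ge0.
  - by move=> k; rewrite mulr_ge0 // exp_coeff_ge0 // nrm_ge0.
  - move=> k; rewrite /u /exp_coeff /= normrM ger0_norm ?invr_ge0 // mulrCA [leRHS]mulrA [leRHS]mulrC.
    by rewrite ler_wpM2l ?invr_ge0 // [leRHS]mulrC; exact: le_trans (nrm_entry _ _ _) (nrmX _ _).
  - rewrite (_ : series _ = (fun m => c * series (exp_coeff (nrm X)) m)).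
      by by apply: is_cvgM; [exact: is_cvg_cst | exact: is_cvg_series_exp_coeff].
    by apply/funext => m; rewrite /series /= mulr_sumr.
rewrite eu; have -> : mexp X i j = limn (series u); last exact: cu.
apply: cvg_UF_unique (cvg_mexp X i j) _; rewrite eu; exact: cvg_UF.
Qed.

End MatrixExp.

(** * Lie algebras of closed groups *)

Section LieAlgebra.
Context {R : realType} {N : nat}.
Implicit Types (X Y A B : 'M[R]_N) (G : 'M[R]_N -> Prop).

(** The derivative of the exponential at 0, along varying directions: by [mexp_approx] the error is
    of order [1/(k+1)]. *)
Lemma scaled_mexp_cvg (X : nat -> 'M[R]_N) L : mcv X L ->
  mcv (fun k => k.+1%:R *: (mexp (k.+1%:R^-1 *: X k) - 1)) L.
Proof.
move=> hX; pose M := nrm L + 1.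
have h : mcv (fun k => k.+1%:R *: (mexp (k.+1%:R^-1 *: X k) - 1) - X k) 0.
  apply: (@mcv_squeeze _ _ _ _ _ (fun k => k.+1%:R^-1 * (M ^+ 2 * expR M))).
    rewrite -(mul0r (M ^+ 2 * expR M)).
    by apply: cvgM; [exact: inv_cvg_UF | exact: cvg_cst].
  apply: filterS (mcv_bounded hX) => k hk; rewrite subr0.
  have k0 : (0 : R) < k.+1%:R by rewrite ltr0n.
  have -> : k.+1%:R *: (mexp (k.+1%:R^-1 *: X k) - 1) - X k
          = k.+1%:R *: (mexp (k.+1%:R^-1 *: X k) - 1 - k.+1%:R^-1 *: X k).
    by rewrite [in RHS]scalerBr scalerA divff ?scale1r // gt_eqF.
  rewrite nrmZ ger0_norm ?(ltW k0) //.
  apply: (@le_trans _ _ (k.+1%:R * (nrm (k.+1%:R^-1 *: X k) ^+ 2 * expR (nrm (k.+1%:R^-1 *: X k))))).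
    by rewrite ler_wpM2l ?(ltW k0) // mexp_approx.
  rewrite nrmZ ger0_norm ?invr_ge0 ?(ltW k0) // exprMn.
  have -> : k.+1%:R * ((k.+1%:R^-1 ^+ 2 * nrm (X k) ^+ 2) * expR (k.+1%:R^-1 * nrm (X k)))
     = k.+1%:R^-1 * (nrm (X k) ^+ 2 * expR (k.+1%:R^-1 * nrm (X k))).
    by move: k0; move: (k.+1%:R : R) => y y0; field; rewrite gt_eqF.
  rewrite ler_wpM2l ?invr_ge0 ?(ltW k0) // ler_pM ?sqr_ge0 ?expR_ge0 //.
    by rewrite lerXn2r ?nnegrE ?nrm_ge0 // (le_trans (nrm_ge0 _) hk).
  rewrite ler_expR; apply: le_trans hk.
  by rewrite ler_piMl ?nrm_ge0 // invf_le1 ?ler1n.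
have := mcvD h hX; rewrite add0r; apply: mcv_near; apply: nearW => k.
by rewrite subrK.
Qed.

Lemma mexp_cvg1 X : mcv (fun k => mexp (k.+1%:R^-1 *: X)) 1.
Proof.
have h := mcvZ inv_cvg_UF (scaled_mexp_cvg (mcv_cst X)).
have := mcvD h (mcv_cst (1 : 'M[R]_N)); rewrite scale0r add0r.
apply: mcv_near; apply: nearW => k.
by rewrite scalerA mulVf ?pnatr_eq0 // scale1r subrK.
Qed.

(** The derivative at 0 of conjugation by [exp (s X)] is the bracket: write [a Y b - Y] as
    [(a - 1) Y b + Y (b - 1)]. *)
Lemma scaled_conj_cvg X Y :
  mcv (fun k => k.+1%:R *: (mexp (k.+1%:R^-1 *: X) *m Y *m mexp (- (k.+1%:R^-1 *: X)) - Y))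
      (X *m Y - Y *m X).
Proof.
have h1 := scaled_mexp_cvg (mcv_cst X).
have h2 := scaled_mexp_cvg (mcv_cst (- X)).
have h3 := mexp_cvg1 (- X).
have h4 := mcvD (mcvM (mcvM h1 (mcv_cst Y)) h3) (mcvM (mcv_cst Y) h2).
rewrite mulmx1 mulmxN in h4; apply: mcv_near h4; apply: nearW => k.
rewrite scalerN; set a := mexp _; set b := mexp _; rewrite -!scalemxAl -scalemxAr -scalerDr.
congr (_ *: _); rewrite !mulmxBl mulmxBr !mulmx1 mul1mx addrA.
by rewrite subrK.
Qed.

(** Closed in the general linear group, not among all matrices: [cg_lim] asks the limit to be
    invertible. *)
Record closed_group G : Prop := ClosedGroup {
  cg_1 : G 1%:M;
  cg_M : forall A B, G A -> G B -> G (A *m B);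
  cg_V : forall A, G A -> A \in unitmx /\ G (invmx A);
  cg_T : forall A, G A -> G A^T;
  cg_lim : forall (A : nat -> 'M[R]_N) L,
    (forall k, G (A k)) -> mcv A L -> L \in unitmx -> G L }.

Definition lieA G X := forall t : R, G (mexp (t *: X)).

Definition Kof G A := G A /\ A^T *m A = 1%:M.

Variables (G : 'M[R]_N -> Prop) (hG : closed_group G).

Lemma cg_X A k : G A -> G (A ^+ k).
Proof.
move=> hA; elim: k => [|k IH]; first exact: cg_1.
by rewrite exprS -mulmxE; apply: cg_M.
Qed.

(** The powers [(g k)^(k+1)] lie in [G] and tend to [mexp X] by [euler_limit]. That the Lie algebra
    is a closed subspace rests on this. *)
Lemma tangent_mexp (g : nat -> 'M[R]_N) X : (forall k, G (g k)) ->
  mcv (fun k => k.+1%:R *: (g k - 1)) X -> G (mexp X).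
Proof.
move=> hg hX; apply: cg_lim (euler_limit hX) (mexp_unit _) => // k.
rewrite scalerA mulVf ?pnatr_eq0 // scale1r addrC subrK; exact: cg_X.
Qed.

Lemma lieA_lim (X : nat -> 'M[R]_N) L : (forall k, lieA G (X k)) -> mcv X L -> lieA G L.
Proof.
move=> hX hL t; apply: tangent_mexp (scaled_mexp_cvg (mcvZ (cvg_cst t) hL)) => k.
rewrite scalerA; exact: hX.
Qed.

Lemma lieAZ a X : lieA G X -> lieA G (a *: X).
Proof. by move=> hX t; rewrite scalerA. Qed.

Lemma lieAN X : lieA G X -> lieA G (- X).
Proof. by rewrite -scaleN1r; exact: lieAZ. Qed.

Lemma lieA0 : lieA G 0.
Proof. by move=> t; rewrite scaler0 mexp0; exact: cg_1. Qed.

(** The products [exp (tX/(k+1)) exp (tY/(k+1))] have tangent [t (X + Y)]. *)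
Lemma lieAD X Y : lieA G X -> lieA G Y -> lieA G (X + Y).
Proof.
move=> hX hY t.
have h := mcvD (mcvM (scaled_mexp_cvg (mcv_cst (t *: X))) (mexp_cvg1 (t *: Y)))
               (scaled_mexp_cvg (mcv_cst (t *: Y))).
rewrite mulmx1 -scalerDr in h.
apply: (@tangent_mexp (fun k => mexp (k.+1%:R^-1 *: (t *: X)) *m mexp (k.+1%:R^-1 *: (t *: Y)))).
  by move=> k; apply: cg_M => //; rewrite scalerA; [exact: hX | exact: hY].
apply: mcv_near h; apply: nearW => k; rewrite -scalemxAl -scalerDr; congr (_ *: _).
by rewrite mulmxBl mul1mx addrA subrK.
Qed.

Lemma lieAB X Y : lieA G X -> lieA G Y -> lieA G (X - Y).
Proof. by move=> hX hY; apply: lieAD => //; exact: lieAN. Qed.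

Lemma lieAT X : lieA G X -> lieA G X^T.
Proof. by move=> hX t; rewrite -linearZ /= mexpT; exact: cg_T. Qed.

Lemma lieA_conj A X : G A -> lieA G X -> lieA G (A *m X *m invmx A).
Proof.
move=> hA hX t; have [uA hV] := cg_V hG hA.
rewrite scalemxAl scalemxAr mexp_conj ?mulVmx //.
by apply: cg_M => //; exact: cg_M.
Qed.

(** The bracket is a limit of rescaled differences of conjugates, all in the Lie algebra, which is
    closed. *)
Lemma lieA_bracket X Y : lieA G X -> lieA G Y -> lieA G (X *m Y - Y *m X).
Proof.
move=> hX hY; apply: lieA_lim (scaled_conj_cvg X Y) => k; apply: lieAZ.
apply: lieAB => //.
have -> : mexp (- (k.+1%:R^-1 *: X)) = invmx (mexp (k.+1%:R^-1 *: X)).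
  rewrite -[RHS]mulmx1 -(mexpN (k.+1%:R^-1 *: X)) mulmxA mulVmx ?mul1mx //.
  exact: mexp_unit.
exact: lieA_conj.
Qed.

End LieAlgebra.

(** * Orthogonal matrices, maximisation over compact groups, spectral theorem *)

Section Compact.
Context {R : realType} {N : nat}.
Implicit Types (X Y A B H : 'M[R]_N) (K G : 'M[R]_N -> Prop).

Definition orth A := A^T *m A = 1%:M.

Lemma orth_inv A : orth A -> A *m A^T = 1%:M.
Proof. exact: mulmx1C. Qed.

Lemma orthM A B : orth A -> orth B -> orth (A *m B).
Proof. by move=> hA hB; rewrite /orth trmx_mul mulmxA -[_ *m _ *m A]mulmxA hA mulmx1. Qed.

Lemma orthT A : orth A -> orth A^T.
Proof. by move=> hA; rewrite /orth trmxK; exact: orth_inv. Qed.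

Lemma orth1 : orth 1%:M.
Proof. by rewrite /orth trmx1 mulmx1. Qed.

Lemma orth_unit A : orth A -> A \in unitmx.
Proof. by move=> hA; case: (mulmx1_unit hA). Qed.

Lemma orth_invmx A : orth A -> invmx A = A^T.
Proof. by move=> hA; rewrite -[LHS]mul1mx -hA mulmxK ?orth_unit. Qed.

Definition orth_bound : R := (N * N)%:R * (N%:R + 1).

Lemma nrm_orth A : orth A -> nrm A <= orth_bound.
Proof. by move=> hA; have := nrm_le_dot A; rewrite /dot hA mxtrace1. Qed.

Lemma orth_lim (A : nat -> 'M[R]_N) L : (forall k, orth (A k)) -> mcv A L -> orth L.
Proof.
move=> hA hL; apply: mcv_unique (mcvM (mcvT hL) hL) _.
by apply: mcv_near (mcv_cst 1%:M); apply: nearW => k; rewrite hA.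
Qed.

Lemma orth_mexp B : B^T = - B -> orth (mexp B).
Proof. by move=> hB; rewrite /orth -mexpT hB mexpNl. Qed.

Lemma dot_orth n A (x y : 'M[R]_(N, n)) : orth A -> dot (A *m x) (A *m y) = dot x y.
Proof. by move=> hA; rewrite /dot trmx_mul mulmxA -[_ *m A]mulmxA hA mulmx1. Qed.

Lemma tr_le_nrm A : `|\tr A| <= nrm A.
Proof.
rewrite /mxtrace (le_trans (ler_norm_sum _ _ _)) //; apply: ler_sum => i _.
by rewrite (bigD1 i) //= lerDl; apply: sumr_ge0.
Qed.

(* At a maximum [k] of [tr (k X k^T H)] on the compact group, the derivative in
   the direction [B] = [H, k X k^T] is [|B|^2]. *)
Lemma exists_commuting_conj K H X :
  K 1%:M -> (forall A B, K A -> K B -> K (A *m B)) -> (forall A, K A -> orth A) ->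
  (forall (A : nat -> 'M[R]_N) L, (forall k, K (A k)) -> mcv A L -> K L) ->
  H^T = H -> X^T = X ->
  (forall k t, K k ->
     K (mexp (t *: (H *m (k *m X *m k^T) - (k *m X *m k^T) *m H)))) ->
  exists2 k, K k & H *m (k *m X *m k^T) = (k *m X *m k^T) *m H.
Proof.
move=> K1 KM KO Kclo HH XX KB.
pose f k := - \tr (k *m X *m k^T *m H).
have [k Kk kmin] : exists2 k, K k & forall k', K k' -> f k <= f k'.
  apply: (@min_attained _ _ _ K f (- (orth_bound * nrm X * orth_bound * nrm H)) 1%:M) => //.
  - move=> k /KO hk; rewrite /f lerN2; apply: le_trans (ler_norm _) _.
    apply: le_trans (tr_le_nrm _) _; apply: le_trans (nrmM _ _) _.
    rewrite ler_wpM2r ?nrm_ge0 //; apply: le_trans (nrmM _ _) _.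
    rewrite ler_pM ?nrm_ge0 ?nrmT ?nrm_orth //.
    by apply: le_trans (nrmM _ _) _; rewrite ler_wpM2r ?nrm_ge0 ?nrm_orth.
  - by exists orth_bound => k /KO hk _; exact: nrm_orth.
  - move=> A L hL; apply: cvgN; apply: mcv_tr; apply: mcvM; last exact: mcv_cst.
    apply: mcvM; last exact: mcvT.
    by apply: mcvM => //; exact: mcv_cst.
exists k => //; set S := k *m X *m k^T.
have SS : S^T = S by rewrite /S !trmx_mul trmxK XX mulmxA.
pose B : 'M[R]_N := H *m S - S *m H.
have BT : B^T = - B by rewrite /B linearB /= (trmx_mul H S) (trmx_mul S H) SS HH opprB.
suff /dot_eq0 : dot B B = 0 by move/eqP; rewrite subr_eq0 => /eqP.
apply/eqP; rewrite eq_le dot_ge0 andbT.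
have -> : dot B B = \tr ((B *m S - S *m B) *m H).
  transitivity (\tr (B *m (S *m H)) - \tr (B *m (H *m S))).
    by rewrite /dot BT mulNmx -mulmxN -linearB /= -mulmxBr; congr (\tr (_ *m _)); rewrite opprB.
  rewrite (mulmxBl (B *m S)) linearB /= mulmxA; congr (_ - _).
  by rewrite mulmxA mxtrace_mulC mulmxA.
have h := mcv_tr (mcvM (scaled_conj_cvg B S) (mcv_cst H)).
apply: cvg_UF_le h _; apply: nearW => m.
rewrite -scalemxAl linearZ /= pmulr_rle0 ?ltr0n // mulmxBl linearB /= subr_le0.
have Ke : K (mexp (m.+1%:R^-1 *: B) *m k) by apply: KM => //; exact: KB.
have := kmin _ Ke; rewrite /f lerN2 /S trmx_mul -mexpT linearZ /= BT scalerN.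
by rewrite !mulmxA.
Qed.

(** The [(i, j)] entry of the commutator is [A i j] times a difference of entries of [h]. *)
Lemma comm_diagP (h : 'rV[R]_N) A :
  A *m diag_mx h = diag_mx h *m A <-> forall i j, A i j != 0 -> h 0 i = h 0 j.
Proof.
split=> [/matrixP hA i j Aij|hA].
  have := hA i j; rewrite mul_mx_diag mul_diag_mx !mxE mulrC.
  by move/mulIf => ->.
apply/matrixP => i j; rewrite mul_mx_diag mul_diag_mx !mxE mulrC.
by have [->|/hA ->] := eqVneq (A i j) 0; rewrite ?mulr0.
Qed.

(** Apply [exists_commuting_conj] to the compact group of orthogonal matrices commuting with
    [diag_mx h]. The entries of [d] are distinct, so a conjugate of [Y] commuting with [diag_mx d]
    is diagonal. The case [h = 0] is the spectral theorem. *)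
Lemma simultaneous_diag (h : 'rV[R]_N) Y :
  Y^T = Y -> Y *m diag_mx h = diag_mx h *m Y ->
  exists Q (y : 'rV[R]_N), [/\ orth Q, Q *m diag_mx h = diag_mx h *m Q &
     Y = Q *m diag_mx y *m Q^T].
Proof.
move=> YY Yh.
pose K A := orth A /\ A *m diag_mx h = diag_mx h *m A.
pose d : 'rV[R]_N := \row_i (i%:R).
have KT A : K A -> A^T *m diag_mx h = diag_mx h *m A^T.
  by move=> [_ hA]; rewrite -[diag_mx h]tr_diag_mx -!trmx_mul hA.
have [] := @exists_commuting_conj K (diag_mx d) Y.
- by split; [exact: orth1 | rewrite mul1mx mulmx1].
- move=> A B [oA hA] [oB hB]; split; first exact: orthM.
  by rewrite -mulmxA hB mulmxA hA mulmxA.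
- by move=> A [].
- move=> A L hA hL; split; first by apply: orth_lim hL => k; case: (hA k).
  apply: mcv_unique (mcvM hL (mcv_cst _)) _.
  apply: mcv_near (mcvM (mcv_cst (diag_mx h)) hL).
  by apply: nearW => k; case: (hA k).
- exact: tr_diag_mx.
- exact: YY.
- move=> k t Kk; set S := k *m Y *m k^T.
  have SS : S^T = S by rewrite /S !trmx_mul trmxK YY mulmxA.
  have Sh : S *m diag_mx h = diag_mx h *m S.
    by rewrite /S -mulmxA KT // -2!mulmxA [Y *m _]mulmxA Yh !mulmxA (proj2 Kk).
  have dh : diag_mx d *m diag_mx h = diag_mx h *m diag_mx d by exact: diag_mxC.
  split.
    apply: orth_mexp; rewrite linearZ /= linearB /= (trmx_mul _ S) (trmx_mul S _) SS tr_diag_mx.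
    by rewrite -scalerN opprB.
  apply: mexp_comm; rewrite -scalemxAl -scalemxAr; congr (_ *: _).
  move: (S) Sh => S' Sh; rewrite mulmxBl mulmxBr -!mulmxA Sh dh.
  by congr (_ - _); rewrite !mulmxA ?dh ?Sh.
move=> k Kk hk; have [ok kh] := Kk.
exists k^T, (\row_i (k *m Y *m k^T) i i); split.
- exact: orthT.
- exact: KT.
have -> : diag_mx (\row_i (k *m Y *m k^T) i i) = k *m Y *m k^T.
  apply/matrixP => i j; rewrite [LHS]mxE [(\row__ _) _ _]mxE.
  have [->|ij] := eqVneq i j; first by rewrite mulr1n.
  rewrite mulr0n; apply/esym/eqP/negPn/negP => nz.
  have /comm_diagP/(_ i j nz) := esym hk; rewrite !mxE => /eqP; rewrite eqr_nat.
  by move/eqP/val_inj/eqP; apply/negP.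
by rewrite trmxK !mulmxA ok mul1mx -mulmxA ok mulmx1.
Qed.

Lemma spectral Y : Y^T = Y ->
  exists Q (y : 'rV[R]_N), orth Q /\ Y = Q *m diag_mx y *m Q^T.
Proof.
move=> YY; have [|Q [y [oQ _ e]]] := @simultaneous_diag 0 Y YY.
  by rewrite linear0 mulmx0 mul0mx.
by exists Q, y.
Qed.

End Compact.

(** * Cartan decomposition *)

Section Cartan.
Context {R : realType} {N : nat}.
Implicit Types (X Y A B H : 'M[R]_N) (G : 'M[R]_N -> Prop).

(* Self-adjoint closed groups which, like algebraic ones, contain the real
   powers of their positive definite elements. *)
Record sa_group G : Prop := SaGroup {
  sa_closed :> closed_group G;
  sa_pow : forall X, X^T = X -> G (mexp X) -> lieA G X }.

Variables (G : 'M[R]_N -> Prop) (hG : sa_group G).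
Local Notation K := (Kof G).

Let cG : closed_group G := sa_closed hG.

Lemma K_orth A : K A -> orth A. Proof. by case. Qed.
Lemma K_G A : K A -> G A. Proof. by case. Qed.

Lemma K_1 : K 1%:M.
Proof. by split; [exact: cg_1 | exact: orth1]. Qed.

Lemma K_M A B : K A -> K B -> K (A *m B).
Proof. by move=> [hA oA] [hB oB]; split; [exact: cg_M | exact: orthM]. Qed.

Lemma K_T A : K A -> K A^T.
Proof. by move=> [hA oA]; split; [exact: cg_T | exact: orthT]. Qed.

Lemma K_lim (A : nat -> 'M[R]_N) L : (forall k, K (A k)) -> mcv A L -> K L.
Proof.
move=> hA hL; have oL : orth L by apply: orth_lim hL => k; case: (hA k).
split=> //; apply: cg_lim hL (orth_unit oL) => // k; exact: K_G.
Qed.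

Lemma K_conj_lieA A X : K A -> lieA G X -> lieA G (A *m X *m A^T).
Proof. by move=> [hA oA] hX; rewrite -orth_invmx //; apply: lieA_conj. Qed.

Lemma diag_conjM (Q : 'M[R]_N) (x y : 'rV[R]_N) : orth Q ->
  (Q *m diag_mx x *m Q^T) *m (Q *m diag_mx y *m Q^T) =
  Q *m diag_mx (\row_i (x 0 i * y 0 i)) *m Q^T.
Proof.
move=> oQ; rewrite !mulmxA -[_ *m Q^T *m Q]mulmxA oQ mulmx1 -[Q *m _ *m _]mulmxA.
by rewrite mulmx_diag.
Qed.

Lemma mexp_diag_conj (Q : 'M[R]_N) (x : 'rV[R]_N) : orth Q ->
  mexp (Q *m diag_mx x *m Q^T) = Q *m diag_mx (map_mx expR x) *m Q^T.
Proof. by move=> oQ; rewrite mexp_conj // mexp_diag. Qed.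

(** [X] is half the logarithm of [A^T A]. As [mexp (2 X) = A^T A] lies in [G], [sa_pow] puts [2 X]
    in the Lie algebra, and [A exp (- X)] is then orthogonal and in [G]. *)
Lemma polar A : G A -> exists k X, [/\ K k, X^T = X, lieA G X & A = k *m mexp X].
Proof.
move=> hA; have [uA _] := cg_V hG hA.
have [Q [y [oQ e]]] := @spectral R N (A^T *m A) ltac:(by rewrite trmx_mul trmxK).
(* The eigenvalue is the squared norm of a column of the invertible matrix [A Q]. *)
have y0 i : 0 < y 0 i.
  have e2 : (A *m Q)^T *m (A *m Q) = diag_mx y.
    rewrite trmx_mul mulmxA -[_ *m A]mulmxA e !mulmxA oQ mul1mx.
    by rewrite -mulmxA oQ mulmx1.
  have -> : y 0 i = \sum_j (A *m Q) j i ^+ 2.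
    have := congr1 (fun M : 'M[R]_N => M i i) e2; rewrite /= mxE [RHS]mxE eqxx mulr1n => <-.
    by apply: eq_bigr => j _; rewrite mxE expr2.
  rewrite lt_def sumr_ge0 ?andbT => [|j _]; last exact: sqr_ge0.
  apply/negP => /eqP /psumr_eq0P h0.
  have uAQ : A *m Q \in unitmx by rewrite unitmx_mul uA orth_unit.
  have : row i (A *m Q)^T = 0.
    apply/rowP => j; rewrite !mxE; apply/eqP; rewrite -sqrf_eq0; apply/eqP.
    by have := h0 (fun j _ => sqr_ge0 _) j isT; rewrite mxE.
  have uAQT : (A *m Q)^T \in unitmx by rewrite unitmx_tr.
  move/(congr1 (fun v => v *m invmx (A *m Q)^T)); rewrite -row_mul mulmxV // mul0mx.
  move/rowP/(_ i); rewrite !mxE eqxx => /eqP; by rewrite oner_eq0.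
pose x : 'rV[R]_N := \row_i (ln (y 0 i) / 2).
have ex : map_mx expR (2 *: x) = y.
  by apply/rowP => i; rewrite !mxE mulrC divfK ?pnatr_eq0 // lnK // posrE.
pose X := Q *m diag_mx x *m Q^T.
have XX : X^T = X by rewrite /X !trmx_mul trmxK tr_diag_mx mulmxA.
have X2 : Q *m diag_mx (2 *: x) *m Q^T = 2 *: X.
  by rewrite linearZ /= -scalemxAr -scalemxAl.
have lX : lieA G X.
  have -> : X = 2^-1 *: (2 *: X) by rewrite scalerA mulVf ?pnatr_eq0 // scale1r.
  apply: lieAZ => //; apply: sa_pow => //; first by rewrite linearZ /= XX.
  rewrite -X2 mexp_diag_conj // ex -e; apply: cg_M => //; exact: cg_T.
exists (A *m mexp (- X)), X; split => //; last first.
  by rewrite -mulmxA mexpNl mulmx1.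
split.
  by apply: cg_M => //; rewrite -scaleN1r; exact: lX.
rewrite trmx_mul -mexpT linearN /= XX mulmxA -[_ *m _ *m A]mulmxA e.
have -> : - X = Q *m diag_mx (- x) *m Q^T by rewrite linearN /= mulmxN mulNmx.
rewrite mexp_diag_conj // !diag_conjM //.
have -> : \row_i ((\row_j (map_mx expR (- x) 0 j * y 0 j)) 0 i * map_mx expR (- x) 0 i) = const_mx 1.
  apply/rowP => i; rewrite !mxE -{2}ex !mxE -!expRD.
  by rewrite -[RHS](expR0 R); congr expR; lra.
by rewrite diag_const_mx mulmx1; exact: orth_inv.
Qed.

(** Minimising this number picks a regular element; its eigenbasis plays the part of a maximal
    abelian subspace. *)
Definition coincidences (h : 'rV[R]_N) : nat :=
  #|[set p : 'I_N * 'I_N | h 0 p.1 == h 0 p.2]%SET|.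

Definition sym_lie X := X^T = X /\ lieA G X.

Lemma regular_exists : exists Q h, [/\ orth Q, sym_lie (Q *m diag_mx h *m Q^T) &
  forall Q' h', orth Q' -> sym_lie (Q' *m diag_mx h' *m Q'^T) ->
    (coincidences h <= coincidences h')%N].
Proof.
pose P n := `[< exists Q h, [/\ orth Q, sym_lie (Q *m diag_mx h *m Q^T) & coincidences h = n] >].
have exP : exists n, P n.
  exists (coincidences 0); apply/asboolP; exists 1%:M, 0; split => //; first exact: orth1.
  by rewrite linear0 mulmx0 mul0mx; split; [rewrite trmx0 | exact: lieA0].
case: (ex_minnP exP) => n /asboolP[Q [h [oQ ph <-]]] nmin.
exists Q, h; split => // Q' h' oQ' ph'; apply: nmin; apply/asboolP; by exists Q', h'.
Qed.

(** A coincidence of [h + e y] with distinct [y] entries forces the ratio [r i j] to be [- e]; so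
    [e] is taken larger than every [|r i j|]. *)
Lemma separate_pairs (h y : 'rV[R]_N) : exists e : R, forall i j,
  h 0 i + e * y 0 i = h 0 j + e * y 0 j -> h 0 i = h 0 j /\ y 0 i = y 0 j.
Proof.
pose r i j : R := (h 0 i - h 0 j) / (y 0 i - y 0 j).
pose e := 1 + \sum_i \sum_j `|r i j|; exists e => i j eij.
have [yij|yij] := eqVneq (y 0 i) (y 0 j).
  by split=> //; move: eij; rewrite yij => /addIr.
have yij0 : y 0 i - y 0 j != 0 by rewrite subr_eq0.
have re : r i j = - e.
  apply: (mulIf yij0); rewrite /r divfK // mulNr mulrBr; move: eij; lra.
have : `|r i j| < e.
  apply: (@le_lt_trans _ _ (\sum_i \sum_j `|r i j|)); last by rewrite /e ltrDr.
  rewrite (bigD1 i) //= (bigD1 j) //= -addrA lerDl addr_ge0 //; first exact: sumr_ge0.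
  by apply: sumr_ge0 => ? _; exact: sumr_ge0.
rewrite re normrN ltNge ler_norm //.
Qed.

(** Conjugate [X] under [K] to a [Y] that commutes with the regular element [H]. Diagonalising [Y]
    together with [H] costs a further rotation [Q'] that need not lie in [K]; regularity shows that
    [Y] was already diagonal in the basis [Q]. *)
Lemma cartan_subspace : exists Q, orth Q /\
  forall X, sym_lie X -> exists k y, [/\ K k, sym_lie (Q *m diag_mx y *m Q^T) &
    X = k^T *m (Q *m diag_mx y *m Q^T) *m k].
Proof.
have [Q [h [oQ [HH lH] hmin]]] := regular_exists.
exists Q; split=> // X [XX lX]; set H := Q *m diag_mx h *m Q^T in HH lH.
have [k Kk kH] : exists2 k, K k & H *m (k *m X *m k^T) = (k *m X *m k^T) *m H.
  apply: exists_commuting_conj => //; [exact: K_1 | exact: K_M | exact: K_orth | exact: K_lim|].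
  move=> k t Kk; have lS := K_conj_lieA Kk lX.
  have SS : (k *m X *m k^T)^T = k *m X *m k^T by rewrite !trmx_mul trmxK XX mulmxA.
  split; first exact: lieA_bracket.
  apply: orth_mexp; rewrite linearZ /= linearB /= (trmx_mul H) (trmx_mul _ H) SS HH.
  by rewrite -scalerN opprB.
set Y := k *m X *m k^T in kH.
have YY : Y^T = Y by rewrite /Y !trmx_mul trmxK XX mulmxA.
have lY : lieA G Y by exact: K_conj_lieA.
pose Y' := Q^T *m Y *m Q.
have YE : Y = Q *m Y' *m Q^T.
  by rewrite /Y' !mulmxA orth_inv // mul1mx -mulmxA orth_inv // mulmx1.
have Y'h : Y' *m diag_mx h = diag_mx h *m Y'.
  have -> : diag_mx h = Q^T *m H *m Q.
    by rewrite /H !mulmxA oQ mul1mx -mulmxA oQ mulmx1.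
  have cj A B : (Q^T *m A *m Q) *m (Q^T *m B *m Q) = Q^T *m (A *m B) *m Q.
    by rewrite !mulmxA -[Q^T *m A *m Q *m Q^T]mulmxA orth_inv // mulmx1.
  by rewrite /Y' !cj kH.
have Y'Y' : Y'^T = Y' by rewrite /Y' (trmx_mul _ Q) (trmx_mul _ Y) trmxK YY mulmxA.
have [Q' [y [oQ' Q'h eY']]] := simultaneous_diag Y'Y' Y'h.
have [e he] := separate_pairs h y.
(* The coincidences of [h + e y] are among those of [h]. Minimality makes the two sets equal, so [y]
   is constant wherever [h] is. *)
have hy i j : h 0 i = h 0 j -> y 0 i = y 0 j.
  move=> hij; have := hmin (Q *m Q') (h + e *: y) (orthM oQ oQ').
  have -> : Q *m Q' *m diag_mx (h + e *: y) *m (Q *m Q')^T = H + e *: Y.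
    rewrite linearD /= linearZ /= mulmxDr mulmxDl; congr (_ + _).
      by rewrite -[Q *m Q' *m _]mulmxA Q'h trmx_mul !mulmxA -[_ *m Q' *m Q'^T]mulmxA orth_inv // mulmx1.
    by rewrite -scalemxAr -scalemxAl YE eY' trmx_mul !mulmxA.
  have pe : sym_lie (H + e *: Y).
    split; first by rewrite linearD /= linearZ /= HH YY.
    by apply: lieAD => //; exact: lieAZ.
  move/(_ pe); rewrite /coincidences => cle.
  pose S1 := [set p : 'I_N * 'I_N | h 0 p.1 == h 0 p.2]%SET.
  pose S2 := [set p : 'I_N * 'I_N | (h + e *: y) 0 p.1 == (h + e *: y) 0 p.2]%SET.
  have sub : S2 \subset S1.
    by apply/fintype.subsetP => p; rewrite !inE !mxE => /eqP/he[-> _].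
  have : S2 == S1 by rewrite eqEcard sub.
  move/eqP/finset.setP/(_ (i, j)); rewrite !inE /= !mxE hij eqxx => /eqP.
  by rewrite -{1}hij => /he[].
(* [Q'] links only indices with equal [h], hence with equal [y]; it commutes with [diag_mx y] and
   cancels. *)
exists k, y; have Y'd : Y' = diag_mx y.
  have Q'y : Q' *m diag_mx y = diag_mx y *m Q'.
    by apply/comm_diagP => i j nz; apply: hy; move/comm_diagP: Q'h; apply.
  by rewrite eY' Q'y -mulmxA orth_inv // mulmx1.
rewrite -Y'd -YE; split => //.
have ok : k^T *m k = 1%:M by exact: K_orth.
by rewrite /Y !mulmxA ok mul1mx -mulmxA ok mulmx1.
Qed.

Lemma KAK : exists Q, orth Q /\ forall A, G A -> exists k l y,
  [/\ K k, K l, lieA G (Q *m diag_mx y *m Q^T) &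
      A = k *m (Q *m diag_mx (map_mx expR y) *m Q^T) *m l].
Proof.
have [Q [oQ hQ]] := cartan_subspace; exists Q; split=> // A hA.
have [k [X [Kk XX lX ->]]] := polar hA.
have [l [y [Kl [_ ly] eX]]] := hQ X (conj XX lX).
exists (k *m l^T), l, y; split=> //; first by apply: K_M => //; exact: K_T.
have ol : l *m l^T = 1%:M by apply: orth_inv; exact: K_orth.
by rewrite eX -{2}[l]trmxK mexp_conj ?trmxK // mexp_diag_conj // !mulmxA.
Qed.

End Cartan.

(** * Critical points in orbit closures *)

Section KempfNess.
Context {R : realType} {N : nat}.
Variables (G : 'M[R]_N -> Prop) (hG : sa_group G).
Local Notation K := (Kof G).
Implicit Types (A X : 'M[R]_N) (v x y u : 'cV[R]_N).

Let cG : closed_group G := sa_closed hG.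

Definition critical x := forall X, lieA G X -> dot (X *m x) x = 0.

Definition orbit_closure v y := forall e : R, 0 < e -> exists2 A, G A & nrm (A *m v - y) < e.

Lemma orbit_closure_seq v y : orbit_closure v y ->
  exists2 A : nat -> 'M[R]_N, (forall k, G (A k)) & mcv (fun k => A k *m v) y.
Proof.
move=> h; have {}h k : exists A, G A /\ nrm (A *m v - y) < k.+1%:R^-1.
  by have [|A] := h k.+1%:R^-1; [rewrite invr_gt0 | exists A].
exists (fun k => projT1 (cid (h k))) => [k|]; first by case: (projT2 (cid (h k))).
apply: (mcv_squeeze inv_cvg_UF); apply: nearW => k; apply: ltW.
by case: (projT2 (cid (h k))).
Qed.

Lemma orbit_closure_lim v (x : nat -> 'cV[R]_N) y :
  (forall k, orbit_closure v (x k)) -> mcv x y -> orbit_closure v y.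
Proof.
move=> hx hy e e0.
have /cvgrPdist_lt/(_ (e / 2)) := mcv_nrm (mcvB hy (mcv_cst y)).
rewrite subrr nrm0 => /(_ ltac:(lra)) /filter_ex[k].
rewrite sub0r normrN ger0_norm ?nrm_ge0 // => hk.
have [|A GA hA] := hx k (e / 2); first lra.
exists A => //; have -> : A *m v - y = (A *m v - x k) + (x k - y) by rewrite addrA subrK.
have := nrmD (A *m v - x k) (x k - y); lra.
Qed.

Lemma orbit_closure_orbit v A : G A -> orbit_closure v (A *m v).
Proof. by move=> GA e e0; exists A => //; rewrite subrr nrm0. Qed.

Lemma orbit_closure_of_seq v (A : nat -> 'M[R]_N) y : (forall k, G (A k)) ->
  mcv (fun k => A k *m v) y -> orbit_closure v y.
Proof. by move=> hA; apply: orbit_closure_lim => k; exact: orbit_closure_orbit. Qed.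

Lemma orbit_closureM v y A : G A -> orbit_closure v y -> orbit_closure v (A *m y).
Proof.
move=> GA /orbit_closure_seq[B GB hB].
apply: (@orbit_closure_of_seq v (fun k => A *m B k)) => [k|]; first exact: cg_M.
by under eq_fun do rewrite -mulmxA; apply: mcvM => //; exact: mcv_cst.
Qed.

Lemma criticalK k x : K k -> critical x -> critical (k *m x).
Proof.
move=> Kk hx X lX; have ok := K_orth Kk.
have -> : X *m (k *m x) = k *m ((k^T *m X *m k) *m x).
  by rewrite !mulmxA orth_inv // mul1mx.
rewrite dot_orth //; apply: hx.
by rewrite -{2}[k]trmxK; apply: K_conj_lieA => //; exact: K_T.
Qed.

Lemma eq_of_sqr (a b : R) : a ^+ 2 = b ^+ 2 -> 0 <= a * b -> a = b.
Proof.
move=> e h; have : (a * b) ^+ 2 = (a ^+ 2) ^+ 2 by rewrite exprMn -e -expr2.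
move/eqP; rewrite eqrXn2 ?sqr_ge0 // => /eqP ab.
apply/eqP; rewrite -subr_eq0 -sqrf_eq0; apply/eqP.
rewrite sqrrB -e ab; ring.
Qed.

(* With [A_j = k_j exp(d_j) l_j], [d_j] diagonal, both limits are critical, so
   [sum_i d_ji (b_i^2 - a_i^2) = 0] where [a], [b] are the coordinates of the
   limits; but eventually [d_ji] has the sign of [b_i^2 - a_i^2]. *)
Lemma critical_limits_conj (A : nat -> 'M[R]_N) (v : nat -> 'cV[R]_N) x y :
  (forall j, G (A j)) -> mcv v x -> mcv (fun j => A j *m v j) y ->
  critical x -> critical y -> exists2 k, K k & y = k *m x.
Proof.
move=> GA hv hAv cx cy; have [Q [oQ hQ]] := KAK hG.
have dec j : exists p : 'M[R]_N * 'M[R]_N * 'rV[R]_N,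
    [/\ K p.1.1, K p.1.2, lieA G (Q *m diag_mx p.2 *m Q^T) &
      A j = p.1.1 *m (Q *m diag_mx (map_mx expR p.2) *m Q^T) *m p.1.2].
  by have [k [l [d h]]] := hQ _ (GA j); exists (k, l, d).
pose p j := projT1 (cid (dec j)).
pose k j := (p j).1.1; pose l j := (p j).1.2; pose d j := (p j).2.
have Kk j : K (k j) by rewrite /k /p; case: (cid (dec j)) => ? [].
have Kl j : K (l j) by rewrite /l /p; case: (cid (dec j)) => ? [].
have ld j : lieA G (Q *m diag_mx (d j) *m Q^T) by rewrite /d /p; case: (cid (dec j)) => ? [].
have eA j : A j = k j *m (Q *m diag_mx (map_mx expR (d j)) *m Q^T) *m l j.
  by rewrite /k /d /l /p; case: (cid (dec j)) => ? [].
clearbody k l d; clear p dec.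
have [k0 hk] : exists L, mcv k L.
  apply: (@bounded_mcv _ _ _ _ (@orth_bound R N)); apply: nearW => j.
  by apply: nrm_orth; exact: K_orth.
have [l0 hl] : exists L, mcv l L.
  apply: (@bounded_mcv _ _ _ _ (@orth_bound R N)); apply: nearW => j.
  by apply: nrm_orth; exact: K_orth.
have Kk0 : K k0 by apply: K_lim hk.
have Kl0 : K l0 by apply: K_lim hl.
pose a := Q^T *m (l0 *m x); pose b := Q^T *m (k0^T *m y).
pose al j := Q^T *m (l j *m v j); pose be j := Q^T *m ((k j)^T *m (A j *m v j)).
have hal : mcv al a by apply: mcvM; [exact: mcv_cst | exact: mcvM].
have hbe : mcv be b by apply: mcvM; [exact: mcv_cst | apply: mcvM => //; exact: mcvT].
have albe j i : be j i 0 = expR (d j 0 i) * al j i 0.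
  have -> : be j = diag_mx (map_mx expR (d j)) *m al j.
    rewrite /be /al eA !mulmxA -[Q^T *m (k j)^T *m k j]mulmxA (K_orth (Kk j)) mulmx1.
    by rewrite oQ mul1mx.
  by rewrite mul_diag_mx !mxE.
have crit0 j z : critical z -> \sum_i d j 0 i * (Q^T *m z) i 0 ^+ 2 = 0.
  move/(_ _ (ld j)) => h0; rewrite -[RHS]h0.
  have -> : dot (Q *m diag_mx (d j) *m Q^T *m z) z = dot (diag_mx (d j) *m (Q^T *m z)) (Q^T *m z).
    by rewrite -(dot_orth _ _ (orthT oQ)) // !mulmxA oQ mul1mx.
  rewrite dotE; move: (Q^T *m z) => w; apply: eq_bigr => i _; rewrite big_ord1 mul_diag_mx !mxE; ring.
have ca := criticalK Kl0 cx; have cb := criticalK (K_T hG Kk0) cy.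
(* A strict inequality between [b_i^2] and [a_i^2] holds eventually between [be_i^2] and [al_i^2],
   whose ratio is [exp (2 d_ji)]; this fixes the sign of [d_ji]. *)
have sgn i : \forall j \near UF, (b i 0 ^+ 2 != a i 0 ^+ 2 -> 0 < d j 0 i * (b i 0 ^+ 2 - a i 0 ^+ 2)).
  have h : (fun j => (be j i 0) ^+ 2 - (al j i 0) ^+ 2) @ UF --> b i 0 ^+ 2 - a i 0 ^+ 2.
    have h1 := hbe i 0; have h2 := hal i 0.
    rewrite !expr2; under eq_fun do rewrite !expr2.
    exact: (cvgB (cvgM h1 h1) (cvgM h2 h2)).
  have E2 j : be j i 0 ^+ 2 = expR (d j 0 i) ^+ 2 * al j i 0 ^+ 2 by rewrite albe exprMn.
  have [e|e|e] := ltrgtP (a i 0 ^+ 2) (b i 0 ^+ 2); last by apply: nearW.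
  - have := cvgr_gt _ h 0; rewrite subr_gt0 => /(_ _ e); apply: filterS => j hj _.
    rewrite mulr_gt0 ?subr_gt0 // ltNge; apply/negP => d0.
    have := ler_expR (d j 0 i) 0; rewrite d0 expR0 => e1.
    have := expR_gt0 (d j 0 i); have := sqr_ge0 (al j i 0); move: hj; rewrite E2 => h1 h2 h3.
    have : expR (d j 0 i) ^+ 2 <= 1 by rewrite expr_le1 // ltW.
    nra.
  - have := cvgr_lt _ h 0; rewrite subr_lt0 => /(_ _ e); apply: filterS => j hj _.
    rewrite -mulrNN mulr_gt0 ?oppr_gt0 ?subr_lt0 // ltNge; apply/negP => d0.
    have := ler_expR 0 (d j 0 i); rewrite d0 expR0 => e1.
    have := sqr_ge0 (al j i 0); move: hj; rewrite E2 => h1 h2.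
    have : 1 <= expR (d j 0 i) ^+ 2 by rewrite expr_ge1 // ltW // expR_gt0.
    nra.
have [j hj] := filter_ex (filter_forall _ sgn).
have sum0 : \sum_i d j 0 i * (b i 0 ^+ 2 - a i 0 ^+ 2) = 0.
  under eq_bigr do rewrite mulrBr.
  by rewrite big_split sumrN /= (crit0 _ _ ca) (crit0 _ _ cb) subrr.
have term0 i : d j 0 i * (b i 0 ^+ 2 - a i 0 ^+ 2) = 0.
  apply: (psumr_eq0P _ sum0) => // i' _.
  by have [->|/hj/ltW] := eqVneq (b i' 0 ^+ 2) (a i' 0 ^+ 2); rewrite ?subrr ?mulr0.
have ab : b = a.
  apply/matrixP => i o; rewrite (ord1 o); apply: eq_of_sqr.
    by apply/eqP/negPn/negP => /hj; rewrite term0 ltxx.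
  (* Equal squares leave a sign open. It is settled because [be_i] is a positive multiple of [al_i]
     before the limit. *)
  apply: cvg_UF_ge (cvgM (hbe i 0) (hal i 0)) _.
  apply: nearW => j'; rewrite /= albe -mulrA mulr_ge0 ?expR_ge0 //.
  by rewrite -expr2 sqr_ge0.
exists (k0 *m l0); first exact: K_M.
have := congr1 (fun w => k0 *m (Q *m w)) ab; rewrite /a /b !mulmxA.
have okT : k0 *m k0^T = 1%:M := orth_inv (K_orth Kk0).
by rewrite -[k0 *m Q *m Q^T]mulmxA orth_inv // mulmx1 okT mul1mx.
Qed.

Lemma critical_unique v x y : orbit_closure v x -> orbit_closure v y ->
  critical x -> critical y -> exists2 k, K k & y = k *m x.
Proof.
move=> /orbit_closure_seq[A GA hA] /orbit_closure_seq[B GB hB].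
apply: (@critical_limits_conj (fun j => B j *m invmx (A j)) (fun j => A j *m v)) => //.
  by move=> j; apply: cg_M => //; case: (cg_V cG (GA j)).
apply: mcv_near hB; apply: nearW => j; rewrite mulmxA mulmxKV //.
by case: (cg_V cG (GA j)).
Qed.

Lemma minimal_critical v u : orbit_closure v u ->
  (forall y, orbit_closure v y -> dot u u <= dot y y) -> critical u.
Proof.
move=> hu umin.
suff ge0 X : lieA G X -> 0 <= dot (X *m u) u.
  move=> X lX; apply/eqP; rewrite eq_le ge0 // andbT.
  by have := ge0 _ (lieAN lX); rewrite mulNmx dotNl oppr_ge0.
(* [|g u|^2 - |u|^2] is the inner product of [g u - u] and [g u + u]. For [g = exp (X/(k+1))] the
   first factor, rescaled, tends to [X u] and the second to [2 u]. *)
move=> lX; suff : 0 <= dot (X *m u) (2 *: u) by rewrite dotZr pmulr_rge0.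
have h1 := mcvM (scaled_mexp_cvg (mcv_cst X)) (mcv_cst u).
have h2 := mcvM (mexp_cvg1 X) (mcv_cst u); rewrite mul1mx in h2.
have h3 := mcv_dot h1 (mcvD h2 (mcv_cst u)).
have -> : 2 *: u = u + u by rewrite scaler_nat mulr2n.
apply: cvg_UF_ge h3 _; apply: nearW => k.
rewrite -scalemxAl dotZl pmulr_rge0 // mulmxBl mul1mx.
rewrite dotBl !dotDr (dotC u (_ *m _)) opprD addrA addrK subr_ge0.
by apply: umin; apply: orbit_closureM.
Qed.

Lemma minimal_exists v : exists2 u, orbit_closure v u &
  forall y, orbit_closure v y -> dot u u <= dot y y.
Proof.
apply: (@min_attained _ _ _ (orbit_closure v) (fun y => dot y y) 0 v).
- by rewrite -[X in orbit_closure _ X]mul1mx; apply: orbit_closure_orbit; exact: cg_1.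
- by move=> y _; exact: dot_ge0.
- exists ((N * 1)%:R * (dot v v + 1 + 1)) => y _ hy.
  by apply: le_trans (nrm_le_dot _) _; rewrite ler_wpM2l // lerD2r.
- by move=> A L; exact: orbit_closure_lim.
- by move=> A L hL; exact: mcv_dot.
Qed.

End KempfNess.

(** * The gradient flow *)

Section Projection.
Context {R : realType} {N : nat}.
Variables (G : 'M[R]_N -> Prop) (hG : sa_group G).
Implicit Types (X Y Z W : 'M[R]_N) (x y u e : 'cV[R]_N).

Let cG : closed_group G := sa_closed hG.

Definition is_projA Y Z := lieA G Z /\ forall W, lieA G W -> dot (Y - Z) W = 0.

(** A nearest point [Z] of the Lie algebra. Orthogonality to [W] follows by moving [Z] along [W] by
    [s], the minimiser of the resulting quadratic. *)
Lemma proj_exists Y : exists Z, is_projA Y Z.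
Proof.
have [Z lZ Zmin] : exists2 Z, lieA G Z & forall W, lieA G W -> dot (Y - Z) (Y - Z) <= dot (Y - W) (Y - W).
  apply: (@min_attained _ _ _ (lieA G) (fun Z => dot (Y - Z) (Y - Z)) 0 0).
  - exact: lieA0.
  - by move=> Z _; exact: dot_ge0.
  - exists (nrm Y + (N * N)%:R * (dot (Y - 0) (Y - 0) + 1 + 1)) => Z _ h.
    have -> : Z = Y - (Y - Z) by rewrite opprB addrC subrK.
    apply: le_trans (nrmD _ _) _; rewrite lerD2l nrmN.
    by apply: le_trans (nrm_le_dot _) _; rewrite ler_wpM2l // lerD2r.
  - by move=> A L; exact: lieA_lim.
  - by move=> A L hL; apply: mcv_dot; apply: mcvB => //; exact: mcv_cst.
exists Z; split=> // W lW; have [->|W0] := eqVneq W 0; first by rewrite dotC dot0l.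
have WW : 0 < dot W W.
  by rewrite lt_def dot_ge0 andbT; apply: contra_neq W0; exact: dot_eq0.
have {Zmin} Dmin (t : R) : dot (Y - Z) (Y - Z) <= dot (Y - Z - t *: W) (Y - Z - t *: W).
  by have := Zmin (Z + t *: W) (lieAD cG lZ (lieAZ t lW)); rewrite opprD addrA.
move: (Y - Z) Dmin => D Dmin.
pose s := dot D W / dot W W; have := Dmin s.
rewrite dotBl !dotBr !dotZl !dotZr (dotC W D).
have es : s * dot W W = dot D W by rewrite /s divfK // gt_eqF.
rewrite es => h; have : dot D W * dot D W <= 0 * dot W W.
  have -> : dot D W * dot D W = (s * dot D W) * dot W W by rewrite -{1}es; ring.
  rewrite ler_wpM2r ?(ltW WW) //; move: h; lra.
rewrite mul0r -expr2 => h2; apply/eqP; by rewrite -sqrf_eq0 eq_le h2 sqr_ge0.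
Qed.

Definition proj Y : 'M[R]_N := projT1 (cid (proj_exists Y)).

Lemma projP Y : is_projA Y (proj Y).
Proof. exact: projT2 (cid (proj_exists Y)). Qed.

(** Linearity and symmetry of [proj], and its agreement with the chosen [projg], are all derived
    from this. *)
Lemma proj_unique Y Z : is_projA Y Z -> Z = proj Y.
Proof.
move=> [lZ hZ]; have [lP hP] := projP Y; apply/eqP; rewrite -subr_eq0; apply/eqP.
have lD : lieA G (Z - proj Y) by exact: lieAB.
apply: dot_eq0; have e : Z - proj Y = (Y - proj Y) - (Y - Z) by apply/matrixP => i j; rewrite !mxE; ring.
by rewrite {1}e dotBl hZ // hP // subrr.
Qed.

Lemma projD Y Y' : proj (Y + Y') = proj Y + proj Y'.
Proof.
apply/esym/proj_unique; have [l h] := projP Y; have [l' h'] := projP Y'.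
split=> [|W lW]; first exact: lieAD.
by rewrite opprD addrACA dotDl h // h' // addr0.
Qed.

Lemma projZ a Y : proj (a *: Y) = a *: proj Y.
Proof.
apply/esym/proj_unique; have [l h] := projP Y; split=> [|W lW]; first exact: lieAZ.
by rewrite -scalerBr dotZl h // mulr0.
Qed.

Lemma projB Y Y' : proj (Y - Y') = proj Y - proj Y'.
Proof. by rewrite projD -scaleN1r projZ scaleN1r. Qed.

Lemma dotT (A B : 'M[R]_N) : dot A^T B^T = dot A B.
Proof.
by rewrite !dotE exchange_big; do 2!apply: eq_bigr => ? _; rewrite !mxE.
Qed.

(** The Lie algebra is stable under transpose. Symmetry of the projection makes the trace of its
    square in [phi] equal to the squared norm [phiA]. *)
Lemma projT Y : Y^T = Y -> (proj Y)^T = proj Y.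
Proof.
move=> YY; apply: proj_unique; have [l h] := projP Y; split; first exact: lieAT.
move=> W lW; rewrite -[W]trmxK -{1}YY -linearB /= dotT; apply: h; exact: lieAT.
Qed.

Lemma dot_proj Y W : lieA G W -> dot (proj Y) W = dot Y W.
Proof. by move=> lW; have [_ h] := projP Y; apply/esym/eqP; rewrite -subr_eq0 -dotBl h. Qed.

Lemma dot_proj_le Y : dot (proj Y) (proj Y) <= dot Y Y.
Proof.
have := dot_ge0 (Y - proj Y); rewrite dotBl !dotBr (dotC (proj Y) Y).
have -> : dot Y (proj Y) = dot (proj Y) (proj Y) by rewrite dot_proj //; case: (projP Y).
lra.
Qed.

Lemma mcv_proj (Y : nat -> 'M[R]_N) L : mcv Y L -> mcv (fun k => proj (Y k)) (proj L).
Proof.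
move=> hY; have hd := mcv_dot (mcvB hY (mcv_cst L)) (mcvB hY (mcv_cst L)).
rewrite subrr dot0l in hd; split=> i j.
have h2 : (fun k => (proj (Y k) i j - proj L i j) ^+ 2) @ UF --> (0 : R).
  apply: cvg_UF_squeeze hd _; apply: nearW => k; rewrite subr0 ger0_norm ?sqr_ge0 //.
  have -> : proj (Y k) i j - proj L i j = proj (Y k - L) i j by rewrite projB !mxE.
  exact: le_trans (sqr_entry_le_dot _ _ _) (dot_proj_le _).
apply/cvgrPdist_lt => e e0; move/cvgrPdist_lt: h2 => /(_ (e ^+ 2)).
rewrite exprn_gt0 // => /(_ isT); apply: filterS => k.
rewrite sub0r normrN ger0_norm ?sqr_ge0 // => h.
by rewrite distrC -(ltr_pXn2r (n := 2)) ?nnegrE ?(ltW e0) // real_normK ?num_real.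
Qed.

(** The moment map: its inner product with [X] in the Lie algebra is that of [X x] with [x], so its
    zeros are the critical points. *)
Definition Zf x : 'M[R]_N := proj (x *m x^T).

Lemma Zf_lie x : lieA G (Zf x).
Proof. by case: (projP (x *m x^T)). Qed.

Lemma Zf_sym x : (Zf x)^T = Zf x.
Proof. by apply: projT; rewrite trmx_mul trmxK. Qed.

Lemma dot_outer X x y : dot X (y *m x^T) = dot (X *m x) y.
Proof. by rewrite /dot trmx_mul mulmxA mxtrace_mulC mulmxA. Qed.

Lemma critical_Zf0 x : Zf x = 0 -> critical G x.
Proof.
move=> h X lX; rewrite -dot_outer dotC -dot_proj // -/(Zf x) h; exact: dot0l.
Qed.

Lemma mcv_Zf (x : nat -> 'cV[R]_N) y : mcv x y -> mcv (fun k => Zf (x k)) (Zf y).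
Proof. by move=> h; apply: mcv_proj; apply: mcvM => //; exact: mcvT. Qed.

Definition phiA x := dot (Zf x) (Zf x).

(** [Zf] is quadratic, so [phiA] is quartic on lines. The factor 4 is 2 from the square times 2 from
    the terms [x e^T] and [e x^T], which pair equally with the symmetric [Zf x]. *)
Lemma phiA_expand x e : exists c2 c3 c4 : R, forall s,
  phiA (x + s *: e) = phiA x + 4 * dot (Zf x *m x) e * s + c2 * s ^+ 2 + c3 * s ^+ 3 + c4 * s ^+ 4.
Proof.
pose B := proj (x *m e^T + e *m x^T); pose C := proj (e *m e^T).
have ZE s : Zf (x + s *: e) = Zf x + s *: B + s ^+ 2 *: C.
  rewrite /Zf /B /C -!projZ -!projD; congr proj.
  rewrite linearD /= linearZ /= mulmxDl !mulmxDr -!scalemxAr -!scalemxAl scalerA -expr2 scalerDr.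
  by rewrite !addrA.
have ZB : dot (Zf x) B = 2 * dot (Zf x *m x) e.
  rewrite dotC dot_proj; last exact: Zf_lie.
  rewrite dotC dotDr !dot_outer.
  have -> : dot (Zf x *m e) x = dot (Zf x *m x) e.
    by rewrite [RHS]dotC /dot trmx_mul Zf_sym mulmxA.
  ring.
exists (dot B B + 2 * dot (Zf x) C), (2 * dot B C), (dot C C) => s.
rewrite /phiA ZE !dotDl !dotDr !dotZl !dotZr (dotC B (Zf x)) (dotC C (Zf x)) (dotC C B) ZB.
move: (dot (Zf x) (Zf x)) (dot B B) (dot (Zf x) C) (dot B C) (dot C C) (dot (Zf x *m x) e).
by move=> a1 a2 a3 a4 a5 a6; ring.
Qed.

End Projection.

(** * The flow in the orbit closure and its convergence modulo [K] *)

Section Flow.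
Context {R : realType} {N : nat}.
Variables (G : 'M[R]_N -> Prop) (hG : sa_group G).
Variables (v u : 'cV[R]_N) (F : R -> 'cV[R]_N).
Local Notation Z := (Zf hG).

Let cG : closed_group G := sa_closed hG.

Hypothesis F0 : F 0 = v.
Hypothesis Fderiv : forall t : R, 0 <= t -> forall e : R, 0 < e -> exists2 d : R, 0 < d &
  forall h : R, `|h| < d -> nrm (F (t + h) - F t + (4 * h) *: (Z (F t) *m F t)) <= e * `|h|.
(** The mean value theorem for [|F|^2]: its derivative is [2 <F', F> = - 8 <Z F, F>], and
    [<Z F, F> = |Z|^2] because [Z] is the projection of [F F^T]. *)
Hypothesis Fmvt : forall s t : R, 0 <= s -> s < t -> exists2 c : R, s < c < t &
  dot (F s) (F s) - dot (F t) (F t) = 8 * (t - s) * phiA hG (F c).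
Hypothesis Cu : orbit_closure G v u.
Hypothesis umin : forall y, orbit_closure G v y -> dot u u <= dot y y.

Lemma flow_norm_decr (s t : R) : 0 <= s -> s <= t -> dot (F t) (F t) <= dot (F s) (F s).
Proof.
move=> s0; rewrite le_eqVlt => /orP[/eqP -> //|st].
have [c _ e] := Fmvt s0 st; rewrite -subr_ge0 e mulr_ge0 ?dot_ge0 //.
by rewrite mulr_ge0 // subr_ge0 ltW.
Qed.

Let B : R := (N * 1)%:R * (dot v v + 1).

Lemma flow_bounded (t : R) : 0 <= t -> nrm (F t) <= B.
Proof.
move=> t0; apply: le_trans (nrm_le_dot _) _; rewrite ler_wpM2l // lerD2r.
by rewrite -F0; exact: flow_norm_decr.
Qed.

Let B0 : 0 <= B.
Proof. by rewrite mulr_ge0 // addr_ge0 ?dot_ge0. Qed.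

(** A bound for [4 nrm (Z (F t))]: the projection does not increase the inner product norm,
    [nrm (F F^T) <= B * B], and [nrm_le_dot] converts back. *)
Let L : R := 4 * ((N * N)%:R * ((B * B) ^+ 2 + 1)).

Let L0 : 0 <= L.
Proof. by rewrite !mulr_ge0 // addr_ge0 ?sqr_ge0. Qed.

Lemma flow_Z_bounded (t : R) : 0 <= t -> 4 * nrm (Z (F t)) <= L.
Proof.
move=> t0; rewrite /L ler_pM2l //; apply: le_trans (nrm_le_dot _) _.
rewrite ler_wpM2l // lerD2r; apply: le_trans (dot_proj_le hG _) _.
apply: le_trans (dot_le_sqr_nrm _) _.
rewrite lerXn2r ?nnegrE ?nrm_ge0 ?(mulr_ge0 B0 B0) //.
apply: le_trans (nrmM _ _) _; rewrite nrmT ler_pM ?nrm_ge0 ?flow_bounded //.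
Qed.

Lemma flow_continuous (s : nat -> R) (t : R) : 0 <= t -> s @ UF --> t -> mcv (fun k => F (s k)) (F t).
Proof.
move=> t0 hs; have [d d0 hd] := Fderiv t0 ltr01.
pose M := 1 + nrm (4 *: (Z (F t) *m F t)).
have M0 : 0 <= M by rewrite addr_ge0 ?nrm_ge0.
have hg : (fun k => `|s k - t| * M) @ UF --> (0 * M : R).
  apply: cvgM; last exact: cvg_cst.
  rewrite -(normr0 R) -(subrr t); apply: cvg_norm; apply: cvgB => //; exact: cvg_cst.
rewrite mul0r in hg; apply: mcv_squeeze hg _.
move/cvgrPdist_lt : hs => /(_ d d0); apply: filterS => k; rewrite distrC => /hd.
rewrite [t + _]addrC subrK mul1r [4 * _]mulrC -scalerA; set h := s k - t => hk.
have -> : F (s k) - F t = (F (s k) - F t + h *: (4 *: (Z (F t) *m F t))) - h *: (4 *: (Z (F t) *m F t)).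
  by rewrite addrK.
apply: le_trans (nrmD _ _) _; rewrite nrmN nrmZ /M mulrDr mulr1; exact: lerD.
Qed.

(* [y'] is [exp (- 4 h Z) y]: it stays in the closure and follows the flow up
   to [o(h)]. *)
Lemma flow_step (t psi : R) y : 0 <= t -> 0 < psi -> orbit_closure G v y -> nrm (F t - y) <= psi ->
  exists2 d : R, 0 < d & forall h : R, 0 <= h -> h < d -> exists2 y', orbit_closure G v y' &
    nrm (F (t + h) - y') <= (1 + (L + 1) * h) * psi.
Proof.
move=> t0 psi0 Cy hy.
have [d d0 hd] := Fderiv t0 (ltac:(lra) : 0 < psi / 2).
pose Y := nrm y; pose q := L ^+ 2 * expR L * Y.
have q0 : 0 <= q.
  by apply: mulr_ge0 (nrm_ge0 _); apply: mulr_ge0 (expR_ge0 _); exact: sqr_ge0.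
(* [d] keeps the flow error below [psi/2 * h], the bound 1 gives [nrm W <= L], and the third keeps
   the quadratic remainder of the exponential, [h * (h * q)], below [psi/2 * h]. *)
exists (Num.min d (Num.min 1 (psi / 2 / (q + 1)))).
  rewrite !lt_min d0 ltr01 divr_gt0 //; lra.
move=> h h0; rewrite !lt_min => /and3P[hhd h1 hq].
pose W := (- (4 * h)) *: Z (F t).
have lW : lieA G W by apply: lieAZ; exact: Zf_lie.
exists (mexp W *m y).
  by apply: orbit_closureM => //; rewrite -[W]scale1r; exact: lW.
have nW : nrm W <= h * L.
  rewrite /W nrmZ normrN ger0_norm ?mulr_ge0 // [4 * h]mulrC -mulrA ler_wpM2l //.
  exact: flow_Z_bounded.
(* Flow error, linear propagation of [F t - y], exponential remainder. Propagation contributes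
   [(1 + L h) psi]; the two errors share the extra [h psi], which is the 1 in [L + 1]. *)
have -> : F (t + h) - mexp W *m y = (F (t + h) - F t + (4 * h) *: (Z (F t) *m F t))
    + ((F t - y) + W *m (F t - y)) - (mexp W - 1 - W) *m y.
  have WF : W *m F t = - ((4 * h) *: (Z (F t) *m F t)) by rewrite /W scaleNr mulNmx scalemxAl.
  rewrite mulmxBr WF !mulmxBl mul1mx.
  move: (F (t + h)) (F t) (mexp W *m y) (W *m y) (_ *: _) => a b c d' e.
  by apply/matrixP => i j; rewrite !mxE; ring.
have n1 : nrm (F (t + h) - F t + (4 * h) *: (Z (F t) *m F t)) <= psi / 2 * h.
  by have := hd h; rewrite ger0_norm //; apply.
have n2 : nrm ((F t - y) + W *m (F t - y)) <= psi + h * L * psi.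
  apply: le_trans (nrmD _ _) _; apply: lerD => //.
  by apply: le_trans (nrmM _ _) _; rewrite ler_pM ?nrm_ge0.
have n3 : nrm ((mexp W - 1 - W) *m y) <= h * (h * q).
  apply: le_trans (nrmM _ _) _.
  have -> : h * (h * q) = (h * L) ^+ 2 * expR L * Y by rewrite /q; ring.
  rewrite ler_wpM2r ?nrm_ge0 //; apply: le_trans (mexp_approx _) _.
  rewrite ler_pM ?sqr_ge0 ?expR_ge0 //.
    by rewrite lerXn2r ?nnegrE ?nrm_ge0 ?(mulr_ge0 h0 L0).
  rewrite ler_expR; apply: le_trans nW _; by rewrite ler_piMl ?(ltW h1).
have n4 : h * q <= psi / 2.
  have : h * (q + 1) <= psi / 2.
    have q1 : 0 < q + 1 by lra.
    by rewrite -ler_pdivlMr // ltW.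
  nra.
have n5 := nrmD (F (t + h) - F t + (4 * h) *: (Z (F t) *m F t) + ((F t - y) + W *m (F t - y)))
  (- ((mexp W - 1 - W) *m y)).
have n6 := nrmD (F (t + h) - F t + (4 * h) *: (Z (F t) *m F t)) ((F t - y) + W *m (F t - y)).
rewrite nrmN in n5; apply: le_trans n5 _.
have n7 : h * (h * q) <= h * (psi / 2) by rewrite ler_wpM2l.
nra.
Qed.

(** A Gronwall estimate by continuous induction. Let [m] be the infimum of the times at which no
    point of the closure lies within [eps * expR ((L + 1) * t)] of the flow. Limits from the left
    give the bound at [m]; [flow_step] carries it beyond [m], since [1 + x <= expR x], which
    contradicts the infimum. Then [eps] tends to 0. *)
Lemma flow_in_closure (t : R) : 0 <= t -> orbit_closure G v (F t).
Proof.
have main (eps : R) : 0 < eps -> forall t : R, 0 <= t ->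
    exists2 y, orbit_closure G v y & nrm (F t - y) <= eps * expR ((L + 1) * t).
  move=> eps0 {}t t0; apply/not_notP => nPt.
  pose psi (t : R) := eps * expR ((L + 1) * t).
  have psi0 s : 0 < psi s by rewrite mulr_gt0 ?expR_gt0.
  have psi_le (s s' : R) : s <= s' -> psi s <= psi s'.
    by move=> ss; rewrite ler_wpM2l ?(ltW eps0) // ler_expR ler_wpM2l // addr_ge0.
  pose P (s : R) := exists2 y, orbit_closure G v y & nrm (F s - y) <= psi s.
  pose S := [set s : R | 0 <= s /\ ~ P s].
  have hS : has_inf S by split; [exists t | exists 0 => s []].
  pose m := inf S.
  have m0 : 0 <= m by apply: lb_le_inf hS.1 _ => s [].
  have before (s : R) : 0 <= s -> s < m -> P s.
    move=> s0 sm; apply/not_notP => nP.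
    have : m <= s by apply: (ge_inf hS.2).
    by rewrite leNgt sm.
  have Pm : P m.
    have [me|mn] := eqVneq m 0.
      exists v; last by rewrite me F0 subrr nrm0 ltW.
      by rewrite -[X in orbit_closure _ _ X]mul1mx; apply: orbit_closure_orbit; exact: cg_1.
    have mp : 0 < m by rewrite lt_def mn.
    pose s k := m - m * k.+1%:R^-1 : R.
    have hs : s @ UF --> m.
      have : s @ UF --> m - m * 0.
        by apply: cvgB; [exact: cvg_cst | apply: cvgM; [exact: cvg_cst | exact: inv_cvg_UF]].
      by rewrite mulr0 subr0.
    have s0 k : 0 <= s k.
      by rewrite /s subr_ge0 ler_piMr // invf_le1 ?ler1n.
    have sm k : s k < m by rewrite /s gtrBl mulr_gt0 // invr_gt0.
    have hy k : exists y, orbit_closure G v y /\ nrm (F (s k) - y) <= psi (s k).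
      by have [y] := before _ (s0 k) (sm k); exists y.
    pose y k := projT1 (cid (hy k)).
    have Cy k : orbit_closure G v (y k) by case: (projT2 (cid (hy k))).
    have ny k : nrm (F (s k) - y k) <= psi m.
      apply: le_trans (psi_le _ _ (ltW (sm k))); by case: (projT2 (cid (hy k))).
    have [y0 hy0] : exists y0, mcv y y0.
      apply: (@bounded_mcv _ _ _ _ (B + psi m)); apply: nearW => k.
      have -> : y k = F (s k) - (F (s k) - y k) by rewrite opprB addrC subrK.
      apply: le_trans (nrmD _ _) _; rewrite nrmN lerD ?flow_bounded //.
    exists y0; first exact: orbit_closure_lim hy0.
    apply: cvg_UF_le (mcv_nrm (mcvB (flow_continuous m0 hs) hy0)) _; exact: nearW.
  have [y Cy hy] := Pm; have [d d0 hd] := flow_step m0 (psi0 m) Cy hy.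
  have [s [s0 nP] smd] := @inf_adherent _ S d d0 hS.
  have ms : m <= s by apply: (ge_inf hS.2).
  apply: nP; have [||y' Cy' hy'] := hd (s - m); first by rewrite subr_ge0.
    by rewrite ltrBlDl.
  exists y' => //; move: hy'; rewrite [m + _]addrC subrK => /le_trans; apply.
  have -> : psi s = expR ((L + 1) * (s - m)) * psi m.
    by rewrite /psi mulrCA -expRD; congr (_ * expR _); ring.
  by rewrite ler_wpM2r ?(ltW (psi0 m)) //; exact: expR_ge1Dx.
move=> t0; pose E := expR ((L + 1) * t).
have h k : exists y, orbit_closure G v y /\ nrm (F t - y) <= k.+1%:R^-1 * E.
  by have [|y Cy hy] := main k.+1%:R^-1 _ t t0; [rewrite invr_gt0 | exists y].
pose y k := projT1 (cid (h k)).
have Cy k : orbit_closure G v (y k) by case: (projT2 (cid (h k))).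
apply: orbit_closure_lim Cy _.
have hg : (fun k : nat => k.+1%:R^-1 * E) @ UF --> (0 * E : R).
  by apply: cvgM; [exact: inv_cvg_UF | exact: cvg_cst].
rewrite mul0r in hg; apply: mcv_squeeze hg _; apply: nearW => k.
rewrite -nrmN opprB; by case: (projT2 (cid (h k))).
Qed.

(** The squared norms at integer times converge, so their successive differences [8 phi (F (c k))]
    tend to 0. The bounds on [c k] let later times be compared with it. *)
Lemma flow_almost_critical : exists (c : nat -> R) w,
  [/\ forall k, k%:R <= c k /\ c k <= k.+1%:R, mcv (fun k => F (c k)) w & Z w = 0].
Proof.
have h (k : nat) : exists c : R, (k%:R < c < k.+1%:R) /\
    dot (F k%:R) (F k%:R) - dot (F k.+1%:R) (F k.+1%:R) = 8 * (k.+1%:R - k%:R) * phiA hG (F c).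
  have [//||c hc e] := Fmvt (_ : 0 <= k%:R) (_ : k%:R < k.+1%:R); first by rewrite ltr_nat.
  by exists c.
pose c k := projT1 (cid (h k)).
have hc k : k%:R < c k < k.+1%:R by case: (projT2 (cid (h k))).
have ec k : dot (F k%:R) (F k%:R) - dot (F k.+1%:R) (F k.+1%:R) = 8 * phiA hG (F (c k)).
  rewrite (projT2 (cid (h k))).2; congr (_ * _).
  by rewrite -natrB // subSnn mulr1.
have c0 k : 0 <= c k by have /andP[/ltW + _] := hc k; apply: le_trans.
have [w hw] : exists w, mcv (fun k => F (c k)) w.
  by apply: (@bounded_mcv _ _ _ _ B); apply: nearW => k; exact: flow_bounded.
exists c, w; split=> //; first by move=> k; have /andP[/ltW ? /ltW ?] := hc k.
pose n (k : nat) := dot (F k%:R) (F k%:R).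
have nc : cvgn n.
  apply: nonincreasing_is_cvgn.
    by apply/nonincreasing_seqP => k; apply: flow_norm_decr => //; rewrite ler_nat.
  by exists 0 => _ [k _ <-]; exact: dot_ge0.
have n1 : n @ UF --> limn n by exact: cvg_UF.
have n2 : (fun k => n k.+1) @ UF --> limn n.
  by apply: (@cvg_UF _ (fun k => n k.+1)); move: nc; rewrite -(cvg_shiftS n).
have n3 : (fun k => 8 * phiA hG (F (c k))) @ UF --> 8 * phiA hG w.
  apply: cvgM; first exact: cvg_cst.
  by apply: mcv_dot; exact: mcv_Zf.
have n4 : (fun k => 8 * phiA hG (F (c k))) @ UF --> (0 : R).
  rewrite -(subrr (limn n)); under eq_fun do rewrite -ec.
  exact: cvgB n1 n2.
have := cvg_UF_unique n3 n4 => /eqP; rewrite mulf_eq0 pnatr_eq0 /= => /eqP.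
exact: dot_eq0.
Qed.

Lemma flow_limit (t : nat -> R) w : (forall k, k%:R <= t k) -> mcv (fun k => F (t k)) w ->
  exists2 k, Kof G k & w = k *m u.
Proof.
move=> ht hw; have cu := minimal_critical hG Cu umin.
have t0 k : 0 <= t k by apply: le_trans (ht k).
have Cw : orbit_closure G v w by apply: orbit_closure_lim hw => k; exact: flow_in_closure.
apply: (critical_unique hG Cu Cw cu); apply: (minimal_critical hG Cw) => y Cy.
apply: le_trans (umin Cy).
have [c [w' [hc hw' Zw']]] := flow_almost_critical.
have c0 k : 0 <= c k by have [h _] := hc k; apply: le_trans h.
have Cw' : orbit_closure G v w' by apply: orbit_closure_lim hw' => k; exact: flow_in_closure.
have [k Kk ew'] := critical_unique hG Cu Cw' cu (critical_Zf0 Zw').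
have -> : dot u u = dot w' w' by rewrite ew' dot_orth //; exact: K_orth Kk.
(* For fixed [m], every [j > m] has [t j >= m + 1 >= c m], so monotonicity of the norm gives
   [|w| <= |F (c m)|]; then [m] grows. *)
apply: cvg_UF_ge (mcv_dot hw' hw') _; apply: nearW => m.
apply: cvg_UF_le (mcv_dot hw hw) _; apply: filterS (UF_ge m.+1) => j mj.
apply: flow_norm_decr => //; have [_ h] := hc m; apply: le_trans h _.
by apply: le_trans (ht j); rewrite ler_nat.
Qed.

Lemma flow_converges (U : 'cV[R]_N -> Prop) :
  (forall y, U y -> exists2 e : R, 0 < e & forall z, nrm (z - y) < e -> U z) ->
  (forall k y, Kof G k -> U y -> U (k *m y)) -> U u ->
  exists T : R, forall t : R, T < t -> U (F t).
Proof.
move=> Uo UK Uu; apply/not_notP => nT.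
have h (k : nat) : exists t : R, k%:R < t /\ ~ U (F t).
  apply/not_notP => nt; apply: nT; exists k%:R => t kt.
  by apply/not_notP => nU; apply: nt; exists t.
pose t k := projT1 (cid (h k)).
have ht k : k%:R <= t k by apply: ltW; case: (projT2 (cid (h k))).
have nU k : ~ U (F (t k)) by case: (projT2 (cid (h k))).
have [w hw] : exists w, mcv (fun k => F (t k)) w.
  apply: (@bounded_mcv _ _ _ _ B); apply: nearW => k; apply: flow_bounded.
  by apply: le_trans (ht k).
have [k Kk ew] := flow_limit ht hw.
have [e e0 he] : exists2 e : R, 0 < e & forall z, nrm (z - w) < e -> U z.
  by apply: Uo; rewrite ew; exact: UK.
have /cvgrPdist_lt/(_ e e0) := mcv_nrm (mcvB hw (mcv_cst w)).
rewrite subrr nrm0 => /filter_ex[j]; rewrite sub0r normrN ger0_norm ?nrm_ge0 // => hj.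
by apply: (nU j); exact: he.
Qed.

End Flow.

(** * Real powers in algebraic groups *)

Section ExpSums.
Context {R : realType}.

(** Real exponential sums form a ring containing the entries of [exp (t X)] for symmetric [X], hence
    every polynomial in those entries. *)
Definition exp_sum (f : R -> R) := exists s : seq (R * R),
  forall t, f t = \sum_(p <- s) p.1 * expR (t * p.2).

Lemma exp_sum_cst c : exp_sum (fun=> c).
Proof. by exists [:: (c, 0)] => t; rewrite big_seq1 /= mulr0 expR0 mulr1. Qed.

Lemma exp_sum_expR w : exp_sum (fun t => expR (t * w)).
Proof. by exists [:: (1, w)] => t; rewrite big_seq1 mul1r. Qed.

Lemma exp_sumD f g : exp_sum f -> exp_sum g -> exp_sum (fun t => f t + g t).
Proof. by move=> [s hs] [r hr]; exists (s ++ r) => t; rewrite big_cat /= hs hr. Qed.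

Lemma exp_sumM f g : exp_sum f -> exp_sum g -> exp_sum (fun t => f t * g t).
Proof.
move=> [s hs] [r hr]; exists [seq (p.1 * q.1, p.2 + q.2) | p <- s, q <- r] => t.
rewrite hs hr mulr_suml big_allpairs_dep /=; apply: eq_bigr => p _.
rewrite mulr_sumr; apply: eq_bigr => q _ /=; rewrite mulrDr expRD; ring.
Qed.

Lemma exp_sumN f : exp_sum f -> exp_sum (fun t => - f t).
Proof.
move=> hf; have [s hs] := exp_sumM (exp_sum_cst (- 1)) hf.
by exists s => t; rewrite -hs mulN1r.
Qed.

Lemma exp_sumB f g : exp_sum f -> exp_sum g -> exp_sum (fun t => f t - g t).
Proof. by move=> hf hg; apply: exp_sumD => //; exact: exp_sumN. Qed.

Lemma exp_sum_sum (I : Type) (r : seq I) (f : I -> R -> R) :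
  (forall i, exp_sum (f i)) -> exp_sum (fun t => \sum_(i <- r) f i t).
Proof.
move=> hf; elim: r => [|i r IH].
  by under eq_fun do rewrite big_nil; exact: exp_sum_cst.
by under eq_fun do rewrite big_cons; exact: exp_sumD.
Qed.

Lemma interpolation (f : R -> R) (s : seq R) :
  exists P : {poly R}, forall x, x \in s -> P.[x] = f x.
Proof.
elim: s => [|a s [P hP]]; first by exists 0.
have [/hP as_|nas] := boolP (a \in s).
  by exists P => x; rewrite inE => /orP[/eqP -> //|/hP].
pose q := \prod_(b <- s) ('X - b%:P).
have qa : q.[a] != 0 by rewrite -[_ == 0]/(root q a) root_prod_XsubC.
exists (P + ((f a - P.[a]) / q.[a]) *: q) => x; rewrite hornerD hornerZ inE => /orP[/eqP ->|xs].
  by rewrite divfK // addrC subrK.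
have /eqP -> : q.[x] == 0 by rewrite -[_ == 0]/(root q x) root_prod_XsubC.
by rewrite mulr0 addr0 hP.
Qed.

(* A polynomial interpolating [expR (t * w)] at the points [expR w] writes the
   value at [t] as a combination of the values at the naturals. *)
Lemma exp_sum_eq0 f : exp_sum f -> (forall m : nat, f m%:R = 0) -> forall t, f t = 0.
Proof.
move=> [s hs] f0 t.
have [P hP] := interpolation (fun y => expR (t * ln y)) [seq expR p.2 | p <- s].
have -> : f t = \sum_(i < size P) P`_i * f i%:R.
  rewrite hs; under [RHS]eq_bigr do rewrite hs mulr_sumr.
  rewrite exchange_big /=; rewrite big_seq [RHS]big_seq; apply: eq_bigr => p ps.
  have := hP (expR p.2) (map_f _ ps); rewrite expRK => <-.
  rewrite horner_coef mulr_sumr; apply: eq_bigr => i _.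
  by rewrite -expRM_natl mulrCA.
by rewrite big1 // => i _; rewrite f0 mulr0.
Qed.

(** This is the remainder of the difference quotient of a quartic. The summand 1 makes the constant
    positive, so that one can divide by it. *)
Lemma cubic_bound (c2 c3 c4 s : R) : `|s| <= 1 ->
  `|c2 * s + c3 * s ^+ 2 + c4 * s ^+ 3| <= `|s| * (`|c2| + `|c3| + `|c4| + 1).
Proof.
move=> s1; apply: le_trans (ler_normD _ _) _.
apply: le_trans (lerD (ler_normD _ _) (lexx _)) _.
rewrite (normrM c2) (normrM c3) (normrM c4) !normrX; have := normr_ge0 s; move: (`|s|) s1 => r r1 r0.
have := normr_ge0 c2; have := normr_ge0 c3; have := normr_ge0 c4.
move: (`|c2|) (`|c3|) (`|c4|) => b2 b3 b4 h4 h3 h2.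
have r2 : r ^+ 2 <= r by rewrite expr2 ler_piMl.
have r3 : r ^+ 3 <= r by rewrite exprS ler_piMr //; exact: le_trans r2 r1.
nra.
Qed.

Context {N : nat}.

Lemma mexp_line (X : 'M[R]_N) : X^T = X -> exists (Q : 'M[R]_N) (x : 'rV[R]_N), orth Q /\
  forall t, mexp (t *: X) = Q *m diag_mx (map_mx expR (t *: x)) *m Q^T.
Proof.
move=> /spectral[Q [x [oQ ->]]]; exists Q, x; split=> // t.
by rewrite -mexp_diag_conj // linearZ /= -scalemxAr -scalemxAl.
Qed.

Lemma mexp_nat (X : 'M[R]_N) m : X^T = X -> mexp (m%:R *: X) = mexp X ^+ m.
Proof.
move=> /mexp_line[Q [x [oQ h]]]; elim: m => [|m IH]; first by rewrite scale0r mexp0.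
rewrite exprSr -IH -[X in _ * mexp X]scale1r !h -mulmxE diag_conjM //.
congr (_ *m diag_mx _ *m _); apply/rowP => i; rewrite !mxE.
by rewrite -expRD -natr1 mulrDl.
Qed.

Lemma exp_sum_mexp (X : 'M[R]_N) i j : X^T = X -> exp_sum (fun t => mexp (t *: X) i j).
Proof.
move=> /mexp_line[Q [x [oQ h]]]; under eq_fun do rewrite h mxE.
apply: exp_sum_sum => k; apply: exp_sumM; last exact: exp_sum_cst.
have -> : (fun t => (Q *m diag_mx (map_mx expR (t *: x))) i k) = (fun t => Q i k * expR (t * x 0 k)).
  by apply/funext => t; rewrite mul_mx_diag !mxE.
by apply: exp_sumM; [exact: exp_sum_cst | exact: exp_sum_expR].
Qed.

End ExpSums.

(** * Realification *)

Section Realification.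
Variable n : nat.
Local Notation N := (Nat.mul 2 n).
Implicit Types (a b : cmat) (M X : 'M[R]_N).


Lemma Cx_eq (z w : Cx) : fst z = fst w -> snd z = snd w -> z = w.
Proof. by case: z w => [? ?] [? ?] /= -> ->. Qed.

Lemma fst_sumC m f : fst (sumC m f) = \sum_(k < m) fst (f k).
Proof. by elim: m => [|m IH]; rewrite ?big_ord0 // big_ord_recr /= -IH. Qed.

Lemma snd_sumC m f : snd (sumC m f) = \sum_(k < m) snd (f k).
Proof. by elim: m => [|m IH]; rewrite ?big_ord0 // big_ord_recr /= -IH. Qed.

Lemma sumRE m f : sumR m f = \sum_(k < m) f k.
Proof. by elim: m => [|m IH]; rewrite ?big_ord0 // big_ord_recr /= -IH. Qed.

Lemma dimE : N = (n + n)%N.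
Proof. by rewrite -[LHS]/(n + (n + 0))%N addn0. Qed.

Lemma sum_halves (f : nat -> R) :
  \sum_(k < N) f k = \sum_(k < n) f k + \sum_(k < n) f (n + k)%N.
Proof. by rewrite dimE big_split_ord. Qed.

Lemma lo_lt k : (k < n)%N -> (k < N)%N.
Proof. by move=> h; rewrite dimE ltn_addr. Qed.

Lemma hi_lt k : (k < n)%N -> (n + k < N)%N.
Proof. by move=> h; rewrite dimE ltn_add2l. Qed.

Lemma half_case i : (i < N)%N ->
  (exists2 k, (k < n)%N & i = k) \/ (exists2 k, (k < n)%N & i = (n + k)%N).
Proof.
rewrite dimE; have [h _|h h2] := ltnP i n; first by left; exists i.
by right; exists (i - n)%N; [rewrite ltn_subLR | rewrite subnKC].
Qed.

Lemma Nat_ltbE i j : Nat.ltb i j = (i < j)%N.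
Proof. by apply/idP/idP => [/Nat.ltb_lt/ssrnat.ltP|/ssrnat.ltP/Nat.ltb_lt]. Qed.

Section RealifyEntries.
Variables (a : cmat) (k l : nat) (hk : (k < n)%N) (hl : (l < n)%N).

Let not_lt m : (n + m < n)%N = false.
Proof. by rewrite -{2}[n]addn0 ltn_add2l. Qed.

Let subK m : Nat.sub (n + m)%N n = m.
Proof. by rewrite -[LHS]/(n + m - n)%N addKn. Qed.

Lemma realify_ll :  realify n a k l = fst (a k l).
Proof. by rewrite /realify !Nat_ltbE hk hl. Qed.

Lemma realify_lh : realify n a k (n + l)%N = - snd (a k l).
Proof. by rewrite /realify !Nat_ltbE hk not_lt subK. Qed.

Lemma realify_hl : realify n a (n + k)%N l = snd (a k l).
Proof. by rewrite /realify !Nat_ltbE hl not_lt subK. Qed.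

Lemma realify_hh : realify n a (n + k)%N (n + l)%N = fst (a k l).
Proof. by rewrite /realify !Nat_ltbE !not_lt !subK. Qed.

End RealifyEntries.

Definition toM (A : rmat) : 'M[R]_N := \matrix_(i, j) A i j.

(** An [rmat] matters only at indices below [N]; this representative is 0 elsewhere. *)
Definition ofM M : rmat := fun i j =>
  if insub i is Some i' then if insub j is Some j' then M i' j' else 0 else 0.

Lemma ofME M (i j : 'I_N) : ofM M i j = M i j.
Proof. by rewrite /ofM !valK. Qed.

Lemma toMK M : toM (ofM M) = M.
Proof. by apply/matrixP => i j; rewrite mxE ofME. Qed.

Lemma ofMK (A : rmat) i j : (i < N)%N -> (j < N)%N -> ofM (toM A) i j = A i j.
Proof. by move=> hi hj; rewrite -[i]/(val (Ordinal hi)) -[j]/(val (Ordinal hj)) ofME mxE. Qed.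

Lemma toM_eqP (A B : rmat) :
  toM A = toM B <-> forall i j, (i < N)%N -> (j < N)%N -> A i j = B i j.
Proof.
split=> [h i j hi hj|h]; first by rewrite -(ofMK A) // h ofMK.
by apply/matrixP => i j; rewrite !mxE; apply: h.
Qed.

Lemma toM_halves (A B : rmat) :
  (forall k l, (k < n)%N -> (l < n)%N ->
     [/\ A k l = B k l, A k (n + l)%N = B k (n + l)%N,
         A (n + k)%N l = B (n + k)%N l & A (n + k)%N (n + l)%N = B (n + k)%N (n + l)%N]) ->
  toM A = toM B.
Proof.
move=> h; apply/toM_eqP => i j.
by move=> /half_case[[k hk ->]|[k hk ->]] /half_case[[l hl ->]|[l hl ->]]; case: (h k l hk hl).
Qed.

Definition cM a := toM (realify n a).

Lemma ofM_mul M X i j : (i < N)%N -> (j < N)%N ->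
  ofM (M *m X) i j =
  \sum_(k < n) ofM M i k * ofM X k j + \sum_(k < n) ofM M i (n + k)%N * ofM X (n + k)%N j.
Proof.
move=> hi hj; rewrite -(sum_halves (fun k => ofM M i k * ofM X k j)).
rewrite -[i]/(val (Ordinal hi)) -[j]/(val (Ordinal hj)) ofME mxE.
by apply: eq_bigr => k _; rewrite !ofME.
Qed.

Lemma cM_entries a k l : (k < n)%N -> (l < n)%N ->
  [/\ ofM (cM a) k l = fst (a k l), ofM (cM a) k (n + l)%N = - snd (a k l),
      ofM (cM a) (n + k)%N l = snd (a k l) & ofM (cM a) (n + k)%N (n + l)%N = fst (a k l)].
Proof.
move=> hk hl; have hkN := lo_lt hk; have hkH := hi_lt hk; have hlN := lo_lt hl; have hlH := hi_lt hl.
rewrite !ofMK //.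
by rewrite !(realify_ll _ hk hl) !(realify_lh _ _ hk) !(realify_hl _ _ hl) !realify_hh.
Qed.

(** Only the left block column is read, so [unr] inverts [cM] just on the matrices satisfying
    [block]. *)
Definition unr M : cmat := fun i j => (ofM M i j, ofM M (n + i)%N j).

Lemma ceqP a b : ceq n a b <-> forall i j, (i < n)%N -> (j < n)%N -> a i j = b i j.
Proof. by split=> h i j hi hj; apply: h; apply/ssrnat.ltP. Qed.

(** The left block column of a product involves only that of the right factor, so [X] may be any
    real matrix. [cM_unitP] applies this to the inverse of [cM a], not yet known to come from a
    complex matrix. *)
Lemma unr_mul a X : ceq n (cmul n a (unr X)) (unr (cM a *m X)).
Proof.
apply/ceqP => i j hi hj; rewrite /unr /cmul.
have hiN := lo_lt hi; have hiH := hi_lt hi; have hjN := lo_lt hj.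
rewrite !ofM_mul //; apply: Cx_eq.
  rewrite fst_sumC /= -big_split; apply: eq_bigr => k _.
  by have [-> -> _ _] := cM_entries a hi (ltn_ord k); rewrite mulNr.
rewrite snd_sumC /= -big_split; apply: eq_bigr => k _.
by have [_ _ -> ->] := cM_entries a hi (ltn_ord k); exact: addrC.
Qed.

Lemma cM_ext a b : ceq n a b -> cM a = cM b.
Proof.
move/ceqP=> h; apply: toM_halves => k l hk hl.
by rewrite !(realify_ll _ hk hl) !(realify_lh _ _ hk) !(realify_hl _ _ hl) !realify_hh h.
Qed.

Lemma unr_cM a : ceq n (unr (cM a)) a.
Proof.
apply/ceqP => i j hi hj; have [h1 _ h2 _] := cM_entries a hi hj.
by rewrite /unr h1 h2 -surjective_pairing.
Qed.

(** Complex linearity, as linear equations on the entries. *)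
Definition block M := forall k l, (k < n)%N -> (l < n)%N ->
  ofM M k (n + l)%N = - ofM M (n + k)%N l /\ ofM M (n + k)%N (n + l)%N = ofM M k l.

Lemma block_cM a : block (cM a).
Proof. by move=> k l hk hl; have [-> -> -> ->] := cM_entries a hk hl. Qed.

Lemma cM_unr M : block M -> cM (unr M) = M.
Proof.
move=> hM; rewrite -[RHS]toMK; apply: toM_halves => k l hk hl.
have [-> ->] := hM _ _ hk hl.
by rewrite !(realify_ll _ hk hl) !(realify_lh _ _ hk) !(realify_hl _ _ hl) !realify_hh.
Qed.

Lemma blockM M X : block M -> block X -> block (M *m X).
Proof.
move=> hM hX k l hk hl; have hkN := lo_lt hk; have hkH := hi_lt hk; have hlN := lo_lt hl; have hlH := hi_lt hl.
rewrite !ofM_mul // -!big_split -sumrN /=; split; apply: eq_bigr => i _.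
  have [e1 e2] := hM _ _ hk (ltn_ord i); have [e3 e4] := hX _ _ (ltn_ord i) hl.
  by rewrite e1 e2 e3 e4; ring.
have [e1 e2] := hM _ _ hk (ltn_ord i); have [e3 e4] := hX _ _ (ltn_ord i) hl.
by rewrite e1 e2 e3 e4; ring.
Qed.

Lemma cM_inj a b : cM a = cM b -> ceq n a b.
Proof.
move=> e; apply/ceqP => i j hi hj.
by have /ceqP <- // := unr_cM a; have /ceqP <- // := unr_cM b; rewrite e.
Qed.

Lemma cM_mul a b : cM (cmul n a b) = cM a *m cM b.
Proof.
rewrite -[RHS]cM_unr; last by apply: blockM; exact: block_cM.
apply: cM_ext; apply/ceqP => i j hi hj.
have /ceqP <- // := unr_mul a (cM b).
rewrite /cmul; apply: Cx_eq; rewrite ?fst_sumC ?snd_sumC.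
  by apply: eq_bigr => k _; have /ceqP -> := unr_cM b.
by apply: eq_bigr => k _; have /ceqP -> := unr_cM b.
Qed.

Lemma cM_1 : cM Defs.cid = 1%:M.
Proof.
rewrite -[RHS]toMK; apply: toM_halves => k l hk hl.
have e1 i j : (i < N)%N -> (j < N)%N -> ofM 1%:M i j = (i == j)%:R.
  by move=> hi hj; rewrite -[i]/(val (Ordinal hi)) -[j]/(val (Ordinal hj)) ofME mxE.
have hlN := lo_lt hl; have hkN := lo_lt hk.
have hlH := hi_lt hl; have hkH := hi_lt hk.
rewrite !e1 // !(realify_ll _ hk hl) !(realify_lh _ _ hk) !(realify_hl _ _ hl) !realify_hh.
have f1 : fst (Defs.cid k l) = (k == l)%:R.
  rewrite /Defs.cid; have -> : Nat.eqb k l = (k == l) by apply/idP/eqP => /Nat.eqb_eq.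
  by case: eqP.
have f2 : snd (Defs.cid k l) = 0 by rewrite /Defs.cid; case: Nat.eqb.
rewrite f1 f2 eqn_add2l oppr0; split=> //.
  by rewrite ltn_eqF // ltn_addr.
by rewrite gtn_eqF // ltn_addr.
Qed.

Lemma cM_adj a : cM (cadj a) = (cM a)^T.
Proof.
have -> : (cM a)^T = toM (fun i j => realify n a j i) by apply/matrixP => i j; rewrite !mxE.
apply: toM_halves => k l hk hl.
rewrite !(realify_ll _ hk hl) !(realify_lh _ _ hk) !(realify_hl _ _ hl) !realify_hh
  ?(realify_ll _ hl hk) !(realify_lh _ _ hl) !(realify_hl _ _ hk); split=> //=.
by rewrite -[RHS]opprK.
Qed.

Lemma cM_unitP a : cinvertible n a <-> cM a \in unitmx.
Proof.
split=> [[b [hab hba]]|ua].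
  by have /mulmx1_unit[] : cM a *m cM b = 1%:M by rewrite -cM_mul (cM_ext hab) cM_1.
pose b := unr (invmx (cM a)).
have hab : ceq n (cmul n a b) Defs.cid.
  apply/ceqP => i j hi hj; have /ceqP -> // := unr_mul a (invmx (cM a)).
  by rewrite mulmxV // -cM_1; have /ceqP -> := unr_cM Defs.cid.
have e : cM a *m cM b = 1%:M by rewrite -cM_mul (cM_ext hab) cM_1.
exists b; split=> //; apply: cM_inj; rewrite cM_mul cM_1; exact: mulmx1C.
Qed.

Lemma ceval_ext a b p : ceq n a b -> ceval n a p = ceval n b p.
Proof.
move/ceqP=> h; elim: p => [i j|c|p IHp q IHq|p IHp q IHq] //=.
- by rewrite !Nat_ltbE; case: andP => // -[hi hj]; exact: h.
- by rewrite IHp IHq.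
- by rewrite IHp IHq.
Qed.

Lemma ceval_cvg (A : nat -> 'M[R]_N) L p : mcv A L ->
  (fun k => fst (ceval n (unr (A k)) p)) @ UF --> fst (ceval n (unr L) p) /\
  (fun k => snd (ceval n (unr (A k)) p)) @ UF --> snd (ceval n (unr L) p).
Proof.
move=> hA; have hof i j : (fun k => ofM (A k) i j) @ UF --> ofM L i j.
  rewrite /ofM; case: insub => [i'|]; last exact: cvg_cst.
  by case: insub => [j'|]; [exact: hA | exact: cvg_cst].
elim: p => [i j|c|p [IHp1 IHp2] q [IHq1 IHq2]|p [IHp1 IHp2] q [IHq1 IHq2]] /=.
- by case: (_ && _) => /=; split; (exact: hof || exact: cvg_cst).
- by split; exact: cvg_cst.
- by split; [exact: cvg_UF_add IHp1 IHq1 | exact: cvg_UF_add IHp2 IHq2].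
- split; first exact: cvg_UF_add (cvg_UF_mul IHp1 IHq1) (cvg_UF_opp (cvg_UF_mul IHp2 IHq2)).
  exact: cvg_UF_add (cvg_UF_mul IHp1 IHq2) (cvg_UF_mul IHp2 IHq1).
Qed.

Lemma ceval_exp_sum (A : R -> 'M[R]_N) p : (forall i j, exp_sum (fun t => A t i j)) ->
  exp_sum (fun t => fst (ceval n (unr (A t)) p)) /\ exp_sum (fun t => snd (ceval n (unr (A t)) p)).
Proof.
move=> hA; have hof i j : exp_sum (fun t => ofM (A t) i j).
  rewrite /ofM; case: insub => [i'|]; last exact: exp_sum_cst.
  by case: insub => [j'|]; [exact: hA | exact: exp_sum_cst].
elim: p => [i j|c|p [IHp1 IHp2] q [IHq1 IHq2]|p [IHp1 IHp2] q [IHq1 IHq2]] /=.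
- by case: (_ && _) => /=; split; (exact: hof || exact: exp_sum_cst).
- by split; exact: exp_sum_cst.
- by split; apply: exp_sumD.
- by split; [apply: exp_sumB | apply: exp_sumD]; apply: exp_sumM.
Qed.

Variable G : cmat -> Prop.
Hypotheses (HZ : zariski_closed_GL n G) (Hgrp : subgroup_GL n G) (Hadj : adj_invariant G).

Definition GA M := exists2 a, G a & M = cM a.

(** Apart from invertibility the conditions are polynomial equations in the real entries: they pass
    to limits, and along [exp (t X)] with [X] symmetric they become exponential sums in [t]. *)
Lemma GA_char : exists S : cpoly -> Prop, forall M,
  GA M <-> [/\ M \in unitmx, block M & forall p, S p -> ceval n (unr M) p = C0].
Proof.
have [S hS] := HZ; exists S => M; split=> [[a Ga ->]|[uM bM hM]].
  have [ia pa] := (hS a).1 Ga; split; [exact/cM_unitP | exact: block_cM |].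
  by move=> p /pa; rewrite (ceval_ext p (unr_cM a)).
exists (unr M); last by rewrite cM_unr.
by apply/hS; split=> //; apply/cM_unitP; rewrite cM_unr.
Qed.

Lemma GA_closed_group : closed_group GA.
Proof.
have [S hS] := GA_char; have [Ginv [G1 [GM GV]]] := Hgrp.
split.
- by exists Defs.cid; rewrite ?cM_1.
- by move=> A B [a Ga ->] [b Gb ->]; exists (cmul n a b); [exact: GM | rewrite cM_mul].
- move=> A [a Ga ->]; have ua : cM a \in unitmx by apply/cM_unitP; exact: Ginv.
  split=> //; have [b [hab hba]] := Ginv a Ga; exists b; first exact: GV hab.
  by rewrite -[LHS]mulmx1 -cM_1 -(cM_ext hab) cM_mul mulKmx.
- by move=> A [a Ga ->]; exists (cadj a); [exact: Hadj | rewrite cM_adj].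
move=> A L GAA hL uL; apply/hS; split=> //.
  have hof i j : (fun k => ofM (A k) i j) @ UF --> ofM L i j.
    rewrite /ofM; case: insub => [i'|]; last exact: cvg_cst.
    by case: insub => [j'|]; [exact: hL | exact: cvg_cst].
  move=> k l hk hl; split.
    have h1 := cvg_UF_opp (hof (n + k)%N l).
    apply: cvg_UF_unique (hof _ _) _; apply: (cvg_UF_near _ h1).
    by apply: nearW => j; have /hS[_ b _] := GAA j; have [-> _] := b _ _ hk hl.
  apply: cvg_UF_unique (hof (n + k)%N (n + l)%N) _; apply: (cvg_UF_near _ (hof k l)).
  by apply: nearW => j; have /hS[_ b _] := GAA j; have [_ ->] := b _ _ hk hl.
move=> p Sp; have [h1 h2] := ceval_cvg p hL.
have h0 j : ceval n (unr (A j)) p = C0 by have /hS[_ _] := GAA j; exact.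
apply: Cx_eq.
  by apply: cvg_UF_unique h1 _; under eq_fun do rewrite h0; exact: cvg_cst.
by apply: cvg_UF_unique h2 _; under eq_fun do rewrite h0; exact: cvg_cst.
Qed.

Lemma GA_sa_group : sa_group GA.
Proof.
split; first exact: GA_closed_group.
move=> X XX GX t; have [S hS] := GA_char.
have Gm m : GA (mexp (m%:R *: X)).
  by rewrite mexp_nat //; apply: cg_X => //; exact: GA_closed_group.
have hes i j : exp_sum (fun t => mexp (t *: X) i j) by exact: exp_sum_mexp.
have hof i j : exp_sum (fun t => ofM (mexp (t *: X)) i j).
  rewrite /ofM; case: insub => [i'|]; last exact: exp_sum_cst.
  by case: insub => [j'|]; [exact: hes | exact: exp_sum_cst].
apply/hS; split; first exact: mexp_unit.
  move=> k l hk hl; split; apply/eqP; rewrite -subr_eq0; apply/eqP.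
    apply: (@exp_sum_eq0 _
      (fun t => ofM (mexp (t *: X)) k (n + l)%N - - ofM (mexp (t *: X)) (n + k)%N l)).
      by apply: exp_sumB; [exact: hof | apply: exp_sumN; exact: hof].
    by move=> m; have /hS[_ b _] := Gm m; have [-> _] := b _ _ hk hl; rewrite subrr.
  apply: (@exp_sum_eq0 _
    (fun t => ofM (mexp (t *: X)) (n + k)%N (n + l)%N - ofM (mexp (t *: X)) k l)).
    exact: exp_sumB.
  by move=> m; have /hS[_ b _] := Gm m; have [_ ->] := b _ _ hk hl; rewrite subrr.
move=> p Sp; have [h1 h2] := ceval_exp_sum p hes.
have h0 m : ceval n (unr (mexp (m%:R *: X))) p = C0 by have /hS[_ _] := Gm m; exact.
apply: Cx_eq.
  by apply: (exp_sum_eq0 h1) => m; rewrite h0.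
by apply: (exp_sum_eq0 h2) => m; rewrite h0.
Qed.

End Realification.

(** * Dictionary between the definitions of the theorem and matrices *)

Section Bridge.
Variables (n : nat) (G : cmat -> Prop).
Local Notation N := (Nat.mul 2 n).
Hypotheses (HZ : zariski_closed_GL n G) (Hgrp : subgroup_GL n G) (Hadj : adj_invariant G).
Local Notation GG := (@GA n G).

Let hG : sa_group GG := GA_sa_group HZ Hgrp Hadj.

Definition toV (x : vec) : 'cV[R]_N := \col_i x i.

Definition ofV (x : 'cV[R]_N) : vec := fun i => if insub i is Some i' then x i' 0 else 0.

Lemma ofVK x : toV (ofV x) = x.
Proof. by apply/colP => i; rewrite mxE /ofV valK. Qed.

Lemma toV_eqP (x y : vec) : toV x = toV y <-> veq N x y.
Proof.
split=> [/colP h i /ssrnat.ltP hi|h]; first by have := h (Ordinal hi); rewrite !mxE.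
by apply/colP => i; rewrite !mxE; apply: h; apply/ssrnat.ltP.
Qed.

Lemma toM_eq_ltP (A B : rmat) : toM n A = toM n B <->
  forall i j, (i < N)%coq_nat -> (j < N)%coq_nat -> A i j = B i j.
Proof.
by split=> [/toM_eqP h i j /ssrnat.ltP ? /ssrnat.ltP ?|h]; [exact: h|];
  apply/toM_eqP => i j /ssrnat.ltP ? /ssrnat.ltP ?; exact: h.
Qed.

Lemma toM_mul (A B : rmat) : toM n (rmul N A B) = toM n A *m toM n B.
Proof.
by apply/matrixP => i j; rewrite !mxE /rmul sumRE; apply: eq_bigr => k _; rewrite !mxE.
Qed.

Lemma toM_id : toM n rid = 1%:M.
Proof.
apply/matrixP => i j; rewrite !mxE /rid.
have -> : Nat.eqb i j = (i == j) by apply/idP/eqP => [/Nat.eqb_eq/val_inj|->] //; exact: Nat.eqb_refl.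
by case: eqP.
Qed.

Lemma toM_pow (A : rmat) k : toM n (rpow N A k) = toM n A ^+ k.
Proof. by elim: k => [|k IH]; rewrite ?toM_id // exprSr -mulmxE -IH toM_mul. Qed.

Lemma toV_apply (A : rmat) (x : vec) : toV (rapply N A x) = toM n A *m toV x.
Proof.
by apply/colP => i; rewrite !mxE /rapply sumRE; apply: eq_bigr => k _; rewrite !mxE.
Qed.

Lemma toM_outer (x : vec) : toM n (outer x) = toV x *m (toV x)^T.
Proof. by apply/matrixP => i j; rewrite !mxE big_ord1 !mxE. Qed.

Lemma toM_scal t (A : rmat) : toM n (rscal t A) = t *: toM n A.
Proof. by apply/matrixP => i j; rewrite !mxE. Qed.

Lemma inner_dot (x y : vec) : inner N x y = dot (toV x) (toV y).
Proof.
by rewrite dotE /inner sumRE; apply: eq_bigr => i _; rewrite big_ord1 !mxE.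
Qed.

Lemma frob_dot (A B : rmat) : frob N A B = dot (toM n A) (toM n B).
Proof.
rewrite dotE /frob sumRE; apply: eq_bigr => i _; rewrite sumRE.
by apply: eq_bigr => j _; rewrite !mxE.
Qed.

Lemma rtrace_tr (A : rmat) : rtrace N A = \tr (toM n A).
Proof. by rewrite /rtrace sumRE; apply: eq_bigr => i _; rewrite mxE. Qed.

Lemma GR_GA (A : rmat) : GR n G A <-> GG (toM n A).
Proof.
split=> [[a [Ga h]]|[a Ga h]]; exists a => //; first by apply/toM_eq_ltP.
by split=> //; apply/toM_eq_ltP.
Qed.

Lemma KR_Kof (A : rmat) : KR n G A <-> Kof GG (toM n A).
Proof.
have e : (toM n A)^T *m toM n A = toM n (fun i j => sumR N (fun k => A k i * A k j)).
  by apply/matrixP => i j; rewrite !mxE sumRE; apply: eq_bigr => k _; rewrite !mxE.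
split=> -[/GR_GA h1 h2]; split=> //; rewrite ?e -?toM_id.
  by apply/toM_eq_ltP.
by apply/toM_eq_ltP; rewrite toM_id -e.
Qed.

Lemma infinite_sumP (u : nat -> R) l : infinite_sum u l <-> series u @ \oo --> (l : R).
Proof.
(* [sum_f_R0 u m] includes the term [u m], while [series u m] stops before it. *)
have e m : sum_f_R0 u m = series u m.+1 by rewrite sum_f_R0E.
split=> [h|/series_cvgP h eps /RltP/h[m hm]].
  apply/series_cvgP => eps /RltP/h[m hm]; exists m => k /ssrnat.leP mk.
  by have := hm k mk; rewrite RdistE e => /RltP.
by exists m => k /ssrnat.leP mk; apply/RltP; rewrite RdistE e; exact: hm.
Qed.

Lemma mexp_term_series (A : rmat) (i j : 'I_N) :
  series (fun k => Rdiv (rpow N A k i j) (INR (Factorial.fact k))) = (fun m => expS (toM n A) m i j).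
Proof.
apply/funext => m; rewrite /series /= big_mkord /expS summxE; apply: eq_bigr => k _.
by rewrite mxE -toM_pow mxE RdivE INRE factE mulrC.
Qed.

(** From left to right the limit along [UF] suffices; the converse uses ordinary convergence from
    [expS_entry_cvg]. *)
Lemma is_mexpP (A E : rmat) : is_mexp N A E <-> toM n E = mexp (toM n A).
Proof.
split=> [h|h i j /ssrnat.ltP hi /ssrnat.ltP hj].
  apply: mexp_unique; split=> i j; apply: cvg_UF.
  have /infinite_sumP := h i j (ssrnat.ltP (ltn_ord i)) (ssrnat.ltP (ltn_ord j)).
  by rewrite mexp_term_series mxE.
apply/infinite_sumP; rewrite (mexp_term_series A (Ordinal hi) (Ordinal hj)).
have -> : E i j = toM n E (Ordinal hi) (Ordinal hj) by rewrite mxE.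
by rewrite h; exact: expS_entry_cvg.
Qed.

Lemma lieP (A : rmat) : lie n G A <-> lieA GG (toM n A).
Proof.
split=> h t => [|E].
  have /h/GR_GA : is_mexp N (rscal t A) (ofM (mexp (t *: toM n A))).
    by apply/is_mexpP; rewrite toMK toM_scal.
  by rewrite toMK.
by move/is_mexpP; rewrite toM_scal => e; apply/GR_GA; rewrite e; exact: h.
Qed.

Lemma critP (x : vec) : crit n G x <-> critical GG (toV x).
Proof.
split=> h X => [lX|/lieP/h]; last by rewrite inner_dot toV_apply.
by have := h (ofM X); rewrite inner_dot toV_apply toMK; apply; apply/lieP; rewrite toMK.
Qed.

Lemma dist_sqrt (x y : vec) : Defs.dist N x y = Num.sqrt (dot (toV x - toV y) (toV x - toV y)).
Proof.
rewrite /Defs.dist RsqrtE sumRE dotE; congr Num.sqrt; apply: eq_bigr => i _.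
by rewrite big_ord1 !mxE RpowE expr2.
Qed.

Lemma dist_le_nrm (x y : vec) : Defs.dist N x y <= nrm (toV x - toV y).
Proof.
rewrite dist_sqrt -[leRHS](ger0_norm (nrm_ge0 _)) -sqrtr_sqr ler_wsqrtr //.
exact: dot_le_sqr_nrm.
Qed.

Lemma nrm_le_dist (x y : vec) : nrm (toV x - toV y) <= N%:R * Defs.dist N x y.
Proof.
rewrite dist_sqrt /nrm; move: (_ - _) => D.
have -> : N%:R * Num.sqrt (dot D D) = \sum_(i < N) Num.sqrt (dot D D).
  by rewrite sumr_const card_ord mulr_natl.
apply: ler_sum => i _; rewrite big_ord1 -sqrtr_sqr ler_wsqrtr //.
exact: sqr_entry_le_dot.
Qed.

(** Dividing by [N + 1] keeps the radius meaningful when [n = 0]. *)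
Lemma nrm_lt_of_dist (x y : vec) e : Defs.dist N x y < e / N.+1%:R -> nrm (toV x - toV y) < e.
Proof.
move=> h; apply: le_lt_trans (nrm_le_dist x y) _.
have d0 : 0 <= Defs.dist N x y by rewrite dist_sqrt sqrtr_ge0.
rewrite ltr_pdivlMr ?ltr0n // in h; apply: le_lt_trans h.
by rewrite mulrC ler_wpM2l // ler_nat.
Qed.

Lemma orbit_closureP (x y : vec) : in_orbit_closure n G x y <-> orbit_closure GG (toV x) (toV y).
Proof.
split=> h e => [e0|/RltP e0].
  have [|A [/GR_GA GAA /RltP hA]] := h (e / N.+1%:R); first by apply/RltP; rewrite divr_gt0.
  by exists (toM n A) => //; rewrite -toV_apply; exact: nrm_lt_of_dist.
have [A GAA hA] := h e e0; exists (ofM A); split; first by apply/GR_GA; rewrite toMK.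
by apply/RltP; apply: le_lt_trans (dist_le_nrm _ _) _; rewrite toV_apply toMK.
Qed.

Lemma K_orbitP (x y : vec) : in_K_orbit n G x y <-> exists2 k, Kof GG k & toV y = k *m toV x.
Proof.
split=> [[k [/KR_Kof Kk /toV_eqP h]]|[k Kk h]].
  by exists (toM n k) => //; rewrite h toV_apply.
exists (ofM k); split; first by apply/KR_Kof; rewrite toMK.
by apply/toV_eqP; rewrite toV_apply toMK.
Qed.

Lemma is_projP (Y Z : rmat) : is_proj n G Y Z <-> is_projA GG (toM n Y) (toM n Z).
Proof.
have eB : toM n (rsub Y Z) = toM n Y - toM n Z by apply/matrixP => i j; rewrite !mxE.
split=> -[/lieP lZ h]; split=> // W; last by move/lieP => lW; rewrite frob_dot eB; exact: h.
move=> lW; by have := h (ofM W); rewrite frob_dot eB toMK; apply; apply/lieP; rewrite toMK.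
Qed.

(** [epsilon] returns some projection because one exists; uniqueness determines its matrix, though
    not its entries beyond [N]. *)
Lemma toM_projg (Y : rmat) : toM n (projg n G Y) = proj hG (toM n Y).
Proof.
apply: proj_unique; apply/is_projP; rewrite /projg; apply: ClassicalEpsilon.epsilon_spec.
by exists (ofM (proj hG (toM n Y))); apply/is_projP; rewrite toMK; exact: projP.
Qed.

Lemma phi_phiA (x : vec) : phi n G x = phiA hG (toV x).
Proof.
rewrite /phi rtrace_tr toM_mul toM_projg toM_outer -/(Zf hG (toV x)).
by rewrite /phiA /dot Zf_sym.
Qed.

Lemma derivable_pt_limP (f : R -> R) (x l : R) : derivable_pt_lim f x l <->
  forall e : R, 0 < e -> exists2 d : R, 0 < d &
    forall h : R, `|h| < d -> `|f (x + h) - f x - h * l| <= e * `|h|.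
Proof.
split=> [h e e0|h e /RltP e0].
  have [[d d0] hd] := h e (RltP e0); exists d; first exact/RltP.
  move=> k kd; have [->|k0] := eqVneq k 0.
    by rewrite addr0 subrr mul0r subrr normr0 mulr0.
  have kn0 : k <> 0 by apply/eqP.
  have := hd k kn0 (RltP kd) => /RltP/ltW.
  rewrite RdivE RabsE => hk.
  have -> : f (x + k) - f x - k * l = ((f (x + k) - f x) / k - l) * k.
    by rewrite mulrBl divfK // [l * k]mulrC.
  by rewrite normrM ler_wpM2r.
(* Halving recovers the strict inequality that [derivable_pt_lim] demands. *)
have e2 : 0 < e / 2 by rewrite divr_gt0.
have [d d0 hd] := h (e / 2) e2; exists (mkposreal d (RltP d0)) => k k0 /RltP kd.
have {}k0 : k != 0 by apply/eqP.
have {}hd := hd k kd; apply/RltP; rewrite RdivE RabsE.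
rewrite -[X in X < _]/(`|(f (x + k) - f x) / k - l|).
have -> : (f (x + k) - f x) / k - l = (f (x + k) - f x - k * l) / k.
  by rewrite [in RHS]mulrBl [k * l]mulrC mulfK.
rewrite normrM normfV ltr_pdivrMr ?normr_gt0 //.
by apply: (le_lt_trans hd); rewrite ltr_pM2r ?normr_gt0 // ltr_pdivrMr // ltr_pMr // ltr1n.
Qed.

(** Along a coordinate direction [phi] is the quartic of [phiA_expand]; uniqueness of derivatives
    identifies [w i] with its linear coefficient. *)
Lemma is_grad_phi (x w : vec) : is_grad N (phi n G) x w ->
  toV w = 4 *: (Zf hG (toV x) *m toV x).
Proof.
move=> h; apply/colP => i; rewrite [LHS]mxE [RHS]mxE.
have := h i (ssrnat.ltP (ltn_ord i)).
have [c2 [c3 [c4 hc]]] := phiA_expand hG (toV x) (delta_mx i 0).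
have e : dot (Zf hG (toV x) *m toV x) (delta_mx i 0) = (Zf hG (toV x) *m toV x) i 0.
  move: (_ *m _) => q; rewrite dotE (bigD1 i) //= big_ord1 mxE !eqxx mulr1 big1 ?addr0 // => j ji.
  by rewrite big_ord1 mxE (negPf ji) mulr0.
have hs s : phi n G (basis_shift x i s) =
    phiA hG (toV x) + 4 * (Zf hG (toV x) *m toV x) i 0 * s + c2 * s ^+ 2 + c3 * s ^+ 3 + c4 * s ^+ 4.
  rewrite phi_phiA -e -hc; congr phiA; apply/colP => j; rewrite !mxE /basis_shift.
  have -> : Nat.eqb j i = (j == i) by apply/idP/eqP => [/Nat.eqb_eq/val_inj|->] //; exact: Nat.eqb_refl.
  by case: eqP => _; rewrite ?mulr1 ?mulr0 ?addr0.
move=> h1; apply: (uniqueness_limite _ _ _ _ h1).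
apply/derivable_pt_limP => eps eps0; pose M := `|c2| + `|c3| + `|c4| + 1.
have M0 : 0 < M by rewrite ltr_wpDl // !addr_ge0.
exists (Num.min 1 (eps / M)); first by rewrite lt_min ltr01 divr_gt0.
move=> s; rewrite lt_min => /andP[s1 sM]; rewrite ltr_pdivlMr // in sM.
rewrite !hs; set p := phiA _ _; set q := _ i 0.
have -> : p + 4 * q * (0 + s) + c2 * (0 + s) ^+ 2 + c3 * (0 + s) ^+ 3 + c4 * (0 + s) ^+ 4
  - (p + 4 * q * 0 + c2 * 0 ^+ 2 + c3 * 0 ^+ 3 + c4 * 0 ^+ 4) - s * (4 * q)
  = (c2 * s + c3 * s ^+ 2 + c4 * s ^+ 3) * s by ring.
rewrite normrM ler_wpM2r //; apply: le_trans (ltW sM).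
by apply: cubic_bound; exact: ltW.
Qed.

Section FlowBridge.
Variables (v : vec) (F : R -> vec).
Hypothesis HF : is_flow n G v F.

Let FV (t : R) : 'cV[R]_N := toV (F t).

Lemma flow_entry_deriv (t : R) (i : 'I_N) : 0 <= t ->
  derivable_pt_lim (fun s => F s i) t (- (4 *: (Zf hG (FV t) *m FV t)) i 0).
Proof.
move=> /RleP t0; have [_ /(_ t t0)[w [/is_grad_phi <- hw]]] := HF.
by rewrite mxE; apply: hw; apply/ssrnat.ltP.
Qed.

Lemma common_radius (I : eqType) (r : seq I) (P : I -> R -> Prop) :
  (forall i, exists2 d : R, 0 < d & P i d) ->
  (forall i d d', d' <= d -> P i d -> P i d') ->
  exists2 d : R, 0 < d & forall i, i \in r -> P i d.
Proof.
move=> hP Pmon; elim: r => [|a r [d d0 hd]]; first by exists 1.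
have [d' d'0 hd'] := hP a; exists (Num.min d d'); first by rewrite lt_min d0.
move=> i; rewrite inE => /orP[/eqP ->|ir].
  by apply: Pmon hd'; rewrite ge_min lexx orbT.
by apply: Pmon (hd i ir); rewrite ge_min lexx.
Qed.

Lemma flow_deriv (t : R) : 0 <= t -> forall e : R, 0 < e -> exists2 d : R, 0 < d &
  forall h : R, `|h| < d ->
    nrm (FV (t + h) - FV t + (4 * h) *: (Zf hG (FV t) *m FV t)) <= e * `|h|.
Proof.
move=> t0 e e0; set Z := Zf hG (FV t) *m FV t.
pose P (i : 'I_N) d := forall h : R, `|h| < d ->
  `|F (t + h) i - F t i - h * - (4 *: Z) i 0| <= e / N.+1%:R * `|h|.
have [|i d d' dd' hP h hd|d d0 hd] := @common_radius 'I_N (enum 'I_N) P.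
- move=> i; have /derivable_pt_limP/(_ (e / N.+1%:R)) := flow_entry_deriv i t0.
  by rewrite divr_gt0 // => /(_ isT).
- by apply: hP; apply: lt_le_trans hd dd'.
exists d => // h hh; rewrite /nrm.
apply: (@le_trans _ _ (\sum_(i < N) e / N.+1%:R * `|h|)).
  apply: ler_sum => i _; rewrite big_ord1.
  have := hd i (mem_enum _ i) h hh; rewrite !mxE mulrN opprK.
  by rewrite [h * _]mulrCA mulrA.
have -> : \sum_(i < N) e / N.+1%:R * `|h| = e * (N%:R / N.+1%:R) * `|h|.
  by rewrite sumr_const card_ord -[LHS]mulr_natl mulrA mulrCA.
rewrite ler_wpM2r // ler_piMr ?(ltW e0) //.
by rewrite ler_pdivrMr // mul1r ler_nat.
Qed.

Lemma flow_mvt (s t : R) : 0 <= s -> s < t -> exists2 c : R, s < c < t &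
  dot (FV s) (FV s) - dot (FV t) (FV t) = 8 * (t - s) * phiA hG (FV c).
Proof.
move=> s0 st; pose f r := sumR N (fun i => Rmult (F r i) (F r i)).
have fE r : f r = dot (FV r) (FV r) by rewrite -inner_dot.
have sumD m (g : R -> nat -> R) (g' : nat -> R) (r : R) :
    (forall i, (i < m)%N -> derivable_pt_lim (fun x => g x i) r (g' i)) ->
    derivable_pt_lim (fun x => sumR m (g x)) r (sumR m g').
  elim: m => [|m IH] hg; first exact: derivable_pt_lim_const.
  apply: derivable_pt_lim_plus; last exact: hg.
  by apply: IH => i im; apply: hg; exact: ltnW.
have [|c [e [sc ct]]] := @MVT_cor2 f (fun r => - (8 * phiA hG (FV r))) s t (RltP st).
  move=> c [/RleP sc _]; have c0 : 0 <= c by apply: le_trans sc.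
  pose D := 4 *: (Zf hG (FV c) *m FV c).
  have -> : - (8 * phiA hG (FV c)) =
      sumR N (fun i => - ofV D i * F c i + F c i * - ofV D i).
    rewrite sumRE.
    have -> : phiA hG (FV c) = dot (Zf hG (FV c) *m FV c) (FV c).
      by rewrite -dot_outer /phiA [RHS]dotC dot_proj //; exact: Zf_lie.
    rewrite dotE mulr_sumr -sumrN; apply: eq_bigr => i _.
    rewrite big_ord1 /ofV valK /D !mxE; move: (\sum_j _) => q; ring.
  apply: (sumD _ (fun r i => Rmult (F r i) (F r i))) => i hi.
  have := flow_entry_deriv (Ordinal hi) c0; rewrite -/D.
  have -> : D (Ordinal hi) 0 = ofV D i by rewrite /ofV (insubT (fun i => (i < N)%N) hi).
  by move=> hd; apply: derivable_pt_lim_mult.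
exists c; first by apply/andP; split; apply/RltP.
have {}e : f t - f s = - (8 * phiA hG (FV c)) * (t - s) by exact: e.
by rewrite -!fE -opprB e mulNr opprK mulrAC.
Qed.

End FlowBridge.

End Bridge.

Theorem theorem16 (n : nat) (G : cmat -> Prop)
  (HZ : zariski_closed_GL n G) (Hgrp : subgroup_GL n G) (Hadj : adj_invariant G)
  (v : vec) :
  exists u : vec,
    (forall y, (in_orbit_closure n G v y /\ crit n G y) <-> in_K_orbit n G u y) /\
    (forall F : R -> vec, is_flow n G v F -> quotient_converges n G F u).
Proof.
have hG := GA_sa_group HZ Hgrp Hadj.
have [u Cu umin] := minimal_exists hG (toV n v).
have cu := minimal_critical hG Cu umin.
exists (ofV u); split=> [y|F HF U Uo UK Uu].
  split=> [[/orbit_closureP Cy /critP cy]|/K_orbitP[k Kk]].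
    by apply/K_orbitP; rewrite ofVK; exact: (critical_unique hG Cu Cy cu cy).
  rewrite ofVK => e; split.
    by apply/orbit_closureP; rewrite e; apply: orbit_closureM => //; case: Kk.
  by apply/critP; rewrite e; apply: criticalK.
(* [U] is a predicate on functions on all naturals; being open for [dist], it cannot see coordinates
   beyond [2 n]. *)
have U_ext x y : toV n x = toV n y -> U x -> U y.
  move=> e Ux; have [eps [/RltP eps0 h]] := Uo x Ux; apply: h; apply/RltP.
  by apply: le_lt_trans (@dist_le_nrm n _ _) _; rewrite e subrr nrm0.
have [||||T hT] := @flow_converges _ _ _ (GA_sa_group HZ Hgrp Hadj) (toV n v) u (fun t => toV n (F t)) _
  (flow_deriv HZ Hgrp Hadj HF) (flow_mvt HZ Hgrp Hadj HF) Cu umin (fun z => U (ofV z)).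
- by apply/toV_eqP; case: HF.
- move=> y Uy; have [eps [/RltP eps0 h]] := Uo _ Uy; exists eps => // z hz.
  by apply: h; apply/RltP; apply: le_lt_trans (@dist_le_nrm n _ _) _; rewrite !ofVK.
- move=> k y Kk Uy; apply: (U_ext (rapply (Nat.mul 2 n) (ofM k) (ofV y))).
    by rewrite toV_apply toMK !ofVK.
  by apply: UK => //; apply/KR_Kof; rewrite toMK.
- exact: Uu.
exists T => t /RltP Tt; apply: U_ext (hT t Tt); exact: ofVK.
Qed.
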